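(* Let $I=[-1,1]$, $\omega(x)=1/\sqrt{1-x^2}$, and let $R$ be a rational function of degree $n$ having no poles on $I$. Let $\mu_0$ be the function associated with $R$ as in the context, and let $\gamma_1=\{z:|z|=1\}$. Then for every $m\in\mathbb N$ and every $\zeta\in\gamma_1$, with $x=\tfrac12(\zeta+1/\zeta)\in I$, $$\frac{|R(x)|^{2m}}{m\mu_0(\zeta)+1}\le\frac1\pi\,\|R\|_{L^{2m}(I;\,\omega)}^{2m}.$$ Furthermore, for $0<p<q\le\infty$, with $m_p$ the integer in $\mathbb N\cap[\tfrac p2,1+\tfrac p2)$, $$\|R\|_{L^q(I;\,\omega)}\le\left(\frac{m_p\,\|\mu_0\|_{L^\infty(\gamma_1)}+1}{\pi}\right)^{\frac1p-\frac1q}\|R\|_{L^p(I;\,\omega)}.$$ Moreover, if $\delta>1$ and all the poles of $R$ lie in the exterior of the ellipse $$\frac12\left(\delta+\frac1\delta\right)\cos t+\frac i2\left(\delta-\frac1\delta\right)\sin t,\qquad t\in\mathbb R,$$ then for $0<p<q\le\infty$ $$\|R\|_{L^q(I;\,\omega)}\le\left(\frac1\pi\right)^{\frac1p-\frac1q}\left(2m_p\,n\cdot\frac{\delta+1}{\delta-1}+1\right)^{\frac1p-\frac1q}\|R\|_{L^p(I;\,\omega)}.$$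
   Context: The degree of a rational function is the number of its poles in $\overline{\mathbb C}=\mathbb C\cup\{\infty\}$ counted with multiplicity; the point $\infty$ belongs to the exterior of the ellipse. For $0<p<\infty$, $\|R\|_{L^p(I;\,\omega)}=\left(\int_I|R(x)|^p\omega(x)\,dx\right)^{1/p}$; for $p=\infty$ it is $\max_I|R|$; $1/\infty=0$. Given a rational function $R$ of degree $n$ without poles on $I$, put $R_1(z)=R\left(\tfrac12(z+1/z)\right)$ and $\mathcal R(z)=R_1(z)\cdot\overline{R_1(1/\overline z)}$. Let $z_1,\dots,z_\nu$ be the pairwise distinct poles of $\mathcal R$ in the disc $|z|<1$ and $n_k$ their multiplicities, where poles are counted without cancellation against zeros: the $z_k$ are the distinct points of $|z|<1$ such that $z_k$ or its reflection $z_k^*=1/\overline{z_k}$ (with $0^*=\infty$) is a pole of $R_1$, and $n_k$ is the multiplicity of $z_k$ as a pole of $R_1$ plus the multiplicity of $z_k^*$ as a pole of $R_1$ (multiplicity $0$ meaning not a pole). Thus $\sum_{k=1}^\nu n_k=2n$. Set $$\mu_0(z)=\sum_{k=1}^{\nu}\frac{n_k(1-|z_k|^2)}{|z-z_k|^2}.$$ *)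

(* Defs.v *)
From mathcomp Require Import all_boot all_order all_algebra.
From mathcomp Require Import fraction complex.
From mathcomp Require Import all_classical all_reals all_analysis.

Set Implicit Arguments.
Unset Strict Implicit.
Unset Printing Implicit Defensive.

Import Order.TTheory GRing.Theory Num.Theory.
Import numFieldNormedType.Exports.

Local Open Scope classical_set_scope.
Local Open Scope ring_scope.
Local Open Scope complex_scope.

Notation cmod := ComplexField.Normc.normc.

(* Elements of the extended plane are of type [option K[i]], with [None]
   standing for the point at infinity. *)

Section Rational.
Variable F : fieldType.
Implicit Types (f g : {fraction {poly F}}) (p : {poly F}).

(* The representative [repr f] need not be in lowest terms. *)
Definition rnum f : {poly F} :=
  let r := frac (repr f) in r.1 %/ gcdp r.1 r.2.
Definition rden f : {poly F} :=
  let r := frac (repr f) in r.2 %/ gcdp r.1 r.2.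

(* Junk value at the poles, where [rden f] vanishes. *)
Definition reval f (x : F) : F := (rnum f).[x] / (rden f).[x].

(* At infinity the subtraction is truncated: 0 when f is finite there. *)
Definition pole_mult f (a : option F) : nat :=
  if a is Some x then mup x (rden f)
  else ((size (rnum f)).-1 - (size (rden f)).-1)%N.

Definition is_pole f (a : option F) : bool := (0 < pole_mult f a)%N.

Definition rdegree f : nat :=
  (\big[addn/0%N]_(a \in [set: option F]) pole_mult f a)%N.

Definition lift_frac p : {poly {fraction {poly F}}} :=
  map_poly (fun c => FracField.tofrac c%:P) p.

(* f o g; meaningful for non-constant g, as the denominator is then nonzero. *)
Definition rcomp f g : {fraction {poly F}} :=
  (lift_frac (rnum f)).[g] / (lift_frac (rden f)).[g].

Definition joukowski : {fraction {poly F}} :=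
  let z := FracField.tofrac ('X : {poly F}) in 2^-1 * (z + z^-1).

End Rational.

Section Bernstein.
Variable K : realType.
Local Notation C := K[i].
Implicit Types (f : {fraction {poly C}}) (z : C).

Definition unit_circle : set C := [set z | cmod z = 1].

Definition reflect_pt z : option C :=
  if z == 0 then None else Some (z^*)^-1.

(* Multiplicity of z as a pole of R_1(z) * conj (R_1(1 / conj z)), where
   R_1 = R o joukowski, without cancellation of poles against zeros. *)
Definition cR_mult f z : nat :=
  (pole_mult (rcomp f (joukowski C)) (Some z)
   + pole_mult (rcomp f (joukowski C)) (reflect_pt z))%N.

Definition cR_poles f : set C := [set z | cmod z < 1 /\ (0 < cR_mult f z)%N].

Definition mu0 f (z : C) : K :=
  \sum_(a \in cR_poles f)
    (cR_mult f a)%:R * (1 - cmod a ^+ 2) / cmod (z - a) ^+ 2.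

Definition mu0_sup f : K := sup [set `|mu0 f z| | z in unit_circle].

Definition segI : set K := `[-1, 1]%classic.

(* omega is 0 instead of +oo at the endpoints, a null set. *)
Definition omega (x : K) : K := (Num.sqrt (1 - x ^+ 2))^-1.

(* For p = +oo the supremum is a maximum as soon as f has no pole on [-1, 1].
   The values at p <= 0 are junk. *)
Definition wnorm (p : \bar K) f : \bar K :=
  match p with
  | r%:E => poweR (\int[lebesgue_measure]_(x in segI)
              ((cmod (reval f x%:C)) `^ r * omega x)%:E)%E r^-1
  | +oo%E => ereal_sup [set (cmod (reval f x%:C))%:E | x in segI]
  | -oo%E => 0%E
  end.

Definition inv_exponent (p : \bar K) : K := if p is r%:E then r^-1 else 0.

Definition ellipse (delta : K) : set (K * K) :=
  [set (2^-1 * (delta + delta^-1) * cos t, 2^-1 * (delta - delta^-1) * sin t)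
   | t in [set: K]].

(* The exterior is the unbounded component of the complement of the curve;
   [connected_component A x] is empty, hence bounded, when x is not in A. *)
Definition ellipse_ext (delta : K) (a : option C) : Prop :=
  if a is Some z then
    ~ bounded_set (connected_component (~` ellipse delta)
                     (complex.Re z, complex.Im z))
  else True.

End Bernstein.

(* Main.v *)
(* On the unit circle, R_1 = R((z + 1/z)/2) has the same modulus as a fraction
   p / prod_b (1 - conj(b) z), where b runs over the poles of R_1 reflected into
   the disc and deg p is at most the number N of the b.  These fractions form a
   space of dimension N + 1 whose reproducing kernel for the normalised arc
   length takes the value 1 + sum_b (1 - |b|^2)/|z - b|^2 = 1 + mu_0(z) on the
   diagonal; the same holds for R_1^m, with each b repeated m times.  This is the
   pointwise bound, the average over the circle being an integral against omega
   by x = cos t.  Applied at a maximum of |R| it bounds max |R| by the L^p norm,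
   and interpolation gives the L^q norms.  If the poles lie outside the ellipse
   then |b| <= 1/delta, so each summand is at most (delta + 1)/(delta - 1), and
   N <= 2n. *)

Require Import Defs.
From mathcomp Require Import all_boot all_order all_algebra.
From mathcomp Require Import fraction complex.
From mathcomp Require Import all_classical all_reals all_analysis.
From mathcomp Require Import measurable_realfun ring lra.

Set Implicit Arguments.
Unset Strict Implicit.
Unset Printing Implicit Defensive.

Import Order.TTheory GRing.Theory Num.Theory.
Import numFieldNormedType.Exports.

Local Open Scope classical_set_scope.
Local Open Scope ring_scope.
Local Open Scope complex_scope.

(** * Modulus and continuity of complex-valued functions *)

Section ComplexModulus.
Variable K : realType.
Local Notation C := K[i].
Implicit Types x y z : C.

(** The kernel is never constructed; its bound comes from an induction on the list of the b. A
    fraction is written (c + (z - a) h) / (1 - conj(a) z). On the circle (z - a) / (1 - conj(a) z)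
    has modulus 1, so the second part has the modulus of h. Its inner product with c / (1 - conj(a)
    z) is the mean of z times a fraction without poles in the closed disc, which is 0. A two-term
    Cauchy-Schwarz inequality then closes the step. Reflecting a pole is harmless because |z - a| =
    |a| |1 - conj(b) z| for |z| = 1 and b = 1/conj(a). A pole at infinity goes to b = 0: it brings
    no factor, but it makes room for the degree of the numerator. To reach an exponent p <= 2m, let
    M be the maximum of h = |R|. The pointwise bound gives M^(2m) <= L * int h^(2m) omega <= L
    M^(2m-p) * int h^p omega, and M^(2m-p) cancels. The integrals against omega are kept as extended
    reals, an infinite value making the bound trivial, and x = cos t enters only as an
    inequality. *)

Lemma cmodE z : `|z| = (cmod z)%:C.
Proof. by []. Qed.

Lemma cmod_ge0 z : 0 <= cmod z.
Proof. by case: z => a b; exact: sqrtr_ge0. Qed.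

Lemma cmod_eq0 z : (cmod z == 0) = (z == 0).
Proof. by rewrite -(normr_eq0 z) cmodE eq_complex /= eqxx andbT. Qed.

Lemma cmod_gt0 z : (0 < cmod z) = (z != 0).
Proof. by rewrite lt_neqAle cmod_ge0 andbT eq_sym cmod_eq0. Qed.

Lemma cmod0 : cmod (0 : C) = 0.
Proof. by apply/eqP; rewrite cmod_eq0. Qed.

Lemma cmod1 : cmod (1 : C) = 1.
Proof. exact: ComplexField.Normc.normc1. Qed.

Lemma cmodM x y : cmod (x * y) = cmod x * cmod y.
Proof. exact: ComplexField.Normc.normcM. Qed.

Lemma cmodV x : cmod x^-1 = (cmod x)^-1.
Proof. exact: ComplexField.Normc.normcV. Qed.

Lemma cmodX x n : cmod (x ^+ n) = cmod x ^+ n.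
Proof. by elim: n => [|n IH]; rewrite ?expr0 ?cmod1// !exprS cmodM IH. Qed.

Lemma cmodJ z : cmod z^*%C = cmod z.
Proof. by case: z => a b /=; rewrite sqrrN. Qed.

Lemma cmodN z : cmod (- z) = cmod z.
Proof. exact: normcN. Qed.

Lemma cmodD x y : cmod (x + y) <= cmod x + cmod y.
Proof. exact: le_normcD. Qed.

Lemma cmodB x y : cmod (x - y) = cmod (y - x).
Proof. by rewrite -cmodN opprB. Qed.

Lemma cmodBB x y : cmod x - cmod y <= cmod (x - y).
Proof. by rewrite lerBlDr; apply: le_trans (cmodD _ _); rewrite subrK. Qed.

Lemma cmod_real (x : K) : cmod x%:C = `|x|.
Proof. by rewrite /= expr0n /= addr0 sqrtr_sqr. Qed.

Lemma cmod_prod (I : Type) (s : seq I) (F : I -> C) :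
  cmod (\prod_(i <- s) F i) = \prod_(i <- s) cmod (F i).
Proof.
by elim/big_rec2: _ => [|i y x _ <-]; [exact: cmod1 | exact: cmodM].
Qed.

Lemma sqr_cmod z : cmod z ^+ 2 = complex.Re z ^+ 2 + complex.Im z ^+ 2.
Proof.
by case: z => a b; rewrite sqr_sqrtr //= addr_ge0 // sqr_ge0.
Qed.

Lemma sqr_cmodC z : (cmod z ^+ 2)%:C = z * z^*%C.
Proof. by rewrite rmorphXn /= -cmodE sqr_normc. Qed.

Lemma ler_Re_cmod z : `|complex.Re z| <= cmod z.
Proof.
by case: z => a b /=; rewrite -sqrtr_sqr ler_wsqrtr // lerDl sqr_ge0.
Qed.

Lemma addcJ_Re z : z + z^*%C = (2 * complex.Re z)%:C.
Proof. by rewrite addcJ rmorphM /= rmorph_nat. Qed.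

Lemma unit_circle_conj z : cmod z = 1 -> z^*%C = z^-1.
Proof.
move=> z1; have z0 : z != 0 by rewrite -cmod_gt0 z1.
by apply: (mulfI z0); rewrite -sqr_cmodC z1 expr1n divff.
Qed.

Lemma conjc_inv z : (z^-1)^*%C = (z^*%C)^-1.
Proof. exact: (fmorphV (@conjc K)). Qed.

End ComplexModulus.

Section ContinuityC.
Variable K : realType.
Local Notation C := K[i].
Local Notation Re := (@complex.Re K).
Local Notation Im := (@complex.Im K).
Implicit Types u v : K -> C.

(** Continuity is read off the two coordinates, so that only limits of real functions have to be
    handled. *)
Definition continuousC u := continuous (Re \o u) /\ continuous (Im \o u).

Lemma continuousC_cst (c : C) : continuousC (fun=> c).
Proof. by split=> x; exact: cvg_cst. Qed.

Lemma continuousC_real : continuousC (fun x : K => x%:C).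
Proof. by split=> x; [exact: cvg_id | exact: cvg_cst]. Qed.

Lemma ReD (x y : C) : Re (x + y) = Re x + Re y.
Proof. by case: x y => ? ? []. Qed.

Lemma ImD (x y : C) : Im (x + y) = Im x + Im y.
Proof. by case: x y => ? ? []. Qed.

Lemma ReM (x y : C) : Re (x * y) = Re x * Re y - Im x * Im y.
Proof. by case: x y => ? ? []. Qed.

Lemma ImM (x y : C) : Im (x * y) = Re x * Im y + Im x * Re y.
Proof. by case: x y => ? ? []. Qed.

Lemma ReV (x : C) : Re x^-1 = Re x / (Re x ^+ 2 + Im x ^+ 2).
Proof. by case: x. Qed.

Lemma ImV (x : C) : Im x^-1 = - Im x / (Re x ^+ 2 + Im x ^+ 2).
Proof. by case: x => a b /=; rewrite mulNr. Qed.

Lemma continuousCD u v : continuousC u -> continuousC v ->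
  continuousC (fun x => u x + v x).
Proof.
move=> [u1 u2] [v1 v2]; split=> x.
  rewrite (_ : _ \o _ = (Re \o u) \+ (Re \o v)); last first.
    by apply/funext => y /=; rewrite ReD.
  by apply: cvgD; [exact: u1 | exact: v1].
rewrite (_ : _ \o _ = (Im \o u) \+ (Im \o v)); last first.
  by apply/funext => y /=; rewrite ImD.
by apply: cvgD; [exact: u2 | exact: v2].
Qed.

Lemma continuousCM u v : continuousC u -> continuousC v ->
  continuousC (fun x => u x * v x).
Proof.
move=> [u1 u2] [v1 v2]; split=> x.
  rewrite (_ : _ \o _ = (Re \o u) \* (Re \o v)
                     \- (Im \o u) \* (Im \o v)); last first.
    by apply/funext => y /=; rewrite ReM.
  by apply: cvgB; apply: cvgM; [exact: u1|exact: v1|exact: u2|exact: v2].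
rewrite (_ : _ \o _ = (Re \o u) \* (Im \o v)
                     \+ (Im \o u) \* (Re \o v)); last first.
  by apply/funext => y /=; rewrite ImM.
by apply: cvgD; apply: cvgM; [exact: u1|exact: v2|exact: u2|exact: v1].
Qed.

Lemma continuous_sqr_cmod u : continuousC u ->
  continuous (fun x => cmod (u x) ^+ 2).
Proof.
move=> [u1 u2] x.
rewrite (_ : (fun x => _) = (Re \o u) \* (Re \o u)
                     \+ (Im \o u) \* (Im \o u)); last first.
  by apply/funext => y; rewrite sqr_cmod !expr2.
by apply: cvgD; apply: cvgM; [exact: u1|exact: u1|exact: u2|exact: u2].
Qed.

Lemma continuous_cmod u : continuousC u -> continuous (fun x => cmod (u x)).
Proof.
move=> cu x.
rewrite (_ : (fun x => _) = Num.sqrt \o (fun x => cmod (u x) ^+ 2)).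
  apply: continuous_comp; [exact: continuous_sqr_cmod | exact: sqrt_continuous].
by apply/funext => y; rewrite /= sqrtr_sqr ger0_norm // cmod_ge0.
Qed.

Lemma continuousCV u : (forall x, u x != 0) -> continuousC u ->
  continuousC (fun x => (u x)^-1).
Proof.
move=> u0 cu; have [u1 u2] := cu.
have cn x : ((fun x => (cmod (u x) ^+ 2)^-1) @ x) --> (cmod (u x) ^+ 2)^-1.
  apply: cvgV; last exact: continuous_sqr_cmod.
  by rewrite sqrf_eq0 cmod_eq0.
split=> x.
  rewrite (_ : _ \o _ = (Re \o u) \* (fun x => (cmod (u x) ^+ 2)^-1)).
    by apply: cvgM; [exact: u1|exact: cn].
  by apply/funext => y /=; rewrite sqr_cmod; case: (u y).
rewrite (_ : _ \o _ = (- (Im \o u)) \* (fun x => (cmod (u x) ^+ 2)^-1)).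
  by apply: cvgM; [apply: cvgN; exact: u2|exact: cn].
apply/funext => y; transitivity (Im (u y)^-1) => //.
rewrite ImV; transitivity (- Im (u y) * (cmod (u y) ^- 2)) => //.
by rewrite sqr_cmod.
Qed.

Lemma continuousC_horner (p : {poly C}) u : continuousC u ->
  continuousC (fun x => p.[u x]).
Proof.
move=> cu; elim/poly_ind: p => [|p c IH].
  under eq_fun do rewrite horner0; exact: continuousC_cst.
under eq_fun do rewrite hornerMXaddC.
apply: continuousCD; last exact: continuousC_cst.
exact: continuousCM.
Qed.

Definition cis (t : K) : C := cos t +i* sin t.

Lemma continuousC_cis : continuousC cis.
Proof. by split=> t; [exact: continuous_cos | exact: continuous_sin]. Qed.

Lemma cmod_cis t : cmod (cis t) = 1.
Proof. by rewrite /= cos2Dsin2 sqrtr1. Qed.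

Lemma cisX t n : cis t ^+ n = cis (t *+ n).
Proof.
elim: n => [|n IH]; first by rewrite expr0 mulr0n /cis cos0 sin0.
rewrite exprS IH mulrS /cis cosD sinD; apply/eqP; rewrite eq_complex /=.
by rewrite eqxx /= addrC.
Qed.

Lemma cisN t : cis (- t) = (cis t)^*%C.
Proof. by rewrite /cis cosN sinN. Qed.

Lemma unit_circleP z : cmod z = 1 -> exists2 t, 0 <= t <= pi &
  z = cis t \/ z = cis (- t).
Proof.
case: z => a b z1; have s1 : a ^+ 2 + b ^+ 2 = 1.
  by have := sqr_cmod (a +i* b); rewrite z1 expr1n.
have a1 : -1 <= a <= 1 by apply/andP; split; nra.
exists (acos a); first by rewrite acos_ge0 ?acos_lepi.
have ca : cos (acos a) = a by apply: acosK; rewrite in_itv.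
have sa : sin (acos a) = `|b|.
  by rewrite sin_acos // -s1 addrAC subrr add0r sqrtr_sqr.
rewrite /cis cosN sinN ca sa; case: (ler0P b) => _; rewrite ?opprK; by [right|left].
Qed.

End ContinuityC.

(** * Averages over the unit circle *)

Section CircleAverage.
Variable K : realType.
Local Notation C := K[i].
Local Notation Re := (@complex.Re K).
Local Notation mu := (@lebesgue_measure K).

(* The upper and the lower half circle are kept apart so that an average over
   the circle of a function of [Re z] is an integral over [0, pi]. *)
Definition circle_avg (u : C -> K) : K :=
  (2 * pi)^-1 * \int[mu]_(t in `[0, pi]) (u (cis t) + u (cis (- t))).

Definition circle_cont (u : C -> K) := continuous (u \o @cis K).

Lemma circle_cont_sym u : circle_cont u ->
  continuous (fun t : K => u (cis t) + u (cis (- t))).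
Proof.
move=> cu t; apply: cvgD; first exact: cu.
apply: (@continuous_comp _ _ _ (@GRing.opp K) (u \o @cis K)); last exact: cu.
exact: opp_continuous.
Qed.

Lemma continuous_integrable_0pi (g : K -> K) : continuous g ->
  mu.-integrable `[0, pi] (EFin \o g).
Proof.
move=> cg; apply: continuous_compact_integrable; first exact: segment_compact.
exact: continuous_subspaceT.
Qed.

Lemma circle_avgD u v : circle_cont u -> circle_cont v ->
  circle_avg (fun z => u z + v z) = circle_avg u + circle_avg v.
Proof.
move=> cu cv; rewrite /circle_avg -mulrDr; congr (_ * _).
rewrite -RintegralD //; try exact/continuous_integrable_0pi/circle_cont_sym.
by apply: eq_Rintegral => t _; rewrite addrACA.
Qed.

Lemma circle_avgZ k u : circle_cont u ->
  circle_avg (fun z => k * u z) = k * circle_avg u.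
Proof.
move=> cu; rewrite /circle_avg mulrCA; congr (_ * _).
rewrite -RintegralZl //; last exact/continuous_integrable_0pi/circle_cont_sym.
by apply: eq_Rintegral => t _; rewrite mulrDr.
Qed.

Lemma eq_circle_avg u v : (forall z, cmod z = 1 -> u z = v z) ->
  circle_avg u = circle_avg v.
Proof.
move=> uv; rewrite /circle_avg; congr (_ * _).
by apply: eq_Rintegral => t _; rewrite !uv // cmod_cis.
Qed.

Lemma circle_avg_even u : circle_cont u ->
  (forall z, cmod z = 1 -> u z = u (z^*%C)) ->
  circle_avg u = pi^-1 * \int[mu]_(t in `[0, pi]) u (cis t).
Proof.
move=> cu ev; rewrite /circle_avg.
have -> : \int[mu]_(t in `[0, pi]) (u (cis t) + u (cis (- t))) =
    2 * \int[mu]_(t in `[0, pi]) u (cis t).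
  rewrite -RintegralZl //; last exact: continuous_integrable_0pi.
  by apply: eq_Rintegral => t _; rewrite cisN -ev ?cmod_cis // mulr_natl mulr2n.
by move: (lt0r_neq0 (pi_gt0 K)); generalize (pi : K) => p p0; field.
Qed.

Lemma Rintegral_0pi_cst (r : K) : \int[mu]_(t in `[0, pi]) r = r * pi.
Proof.
rewrite Rintegral_cst //; apply: (congr1 (fun x => r * fine x) (y := pi%:E)).
have := lebesgue_measure_itv `[(0 : K), pi].
by rewrite lte_fin pi_gt0 -EFinB subr0.
Qed.

Lemma circle_avg_cst r : circle_avg (fun=> r) = r.
Proof.
rewrite /circle_avg Rintegral_0pi_cst.
by move: (lt0r_neq0 (pi_gt0 K)); generalize (pi : K) => p p0; field.
Qed.

Lemma le_circle_avg u v : circle_cont u -> circle_cont v ->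
  (forall z, cmod z = 1 -> u z <= v z) -> circle_avg u <= circle_avg v.
Proof.
move=> cu cv uv; rewrite /circle_avg ler_wpM2l //.
  by rewrite invr_ge0 mulr_ge0 // pi_ge0.
apply: le_Rintegral => //; try exact/continuous_integrable_0pi/circle_cont_sym.
by move=> t _; rewrite lerD // uv // cmod_cis.
Qed.

Lemma circle_avg_ge0 u : (forall z, cmod z = 1 -> 0 <= u z) -> 0 <= circle_avg u.
Proof.
move=> u0; rewrite /circle_avg mulr_ge0 //.
  by rewrite invr_ge0 mulr_ge0 // pi_ge0.
by apply: Rintegral_ge0 => t _; rewrite addr_ge0 // u0 // cmod_cis.
Qed.

Lemma Rintegral_cos_mulrn k :
  \int[mu]_(t in `[0, pi]) cos (t *+ k.+1 : K) = 0.
Proof.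
pose F t : K := k.+1%:R^-1 * sin (k.+1%:R * t).
have dF (t : K) : is_derive t 1 F (cos (t *+ k.+1)).
  have d1 : is_derive t (1 : K) (fun s : K => k.+1%:R * s) k.+1%:R.
    by apply: is_derive_eq; rewrite [LHS]mulr1.
  have d2 : is_derive (k.+1%:R * t : K) (1 : K) sin (cos (k.+1%:R * t)).
    exact: is_derive_sin.
  have d3 := @is_derive1_comp _ sin (fun s : K => k.+1%:R * s) t _ _ d2 d1.
  have := is_deriveZ k.+1%:R^-1 d3.
  rewrite /F => d4; apply: is_derive_eq d4 _.
  rewrite -[t *+ _]mulr_natl.
  change (k.+1%:R^-1 * (cos (k.+1%:R * t) * k.+1%:R) = cos (k.+1%:R * t)).
  by rewrite mulrCA mulVf ?pnatr_eq0 // mulr1.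
have cF : continuous F.
  by move=> t; apply: differentiable_continuous; apply/derivable1_diffP; exact: ex_derive.
rewrite /Rintegral (@continuous_FTC2 _ _ F) ?pi_gt0 //.
- rewrite /F mulr0 sin0 mulr0 -EFinB subr0 /= mulr_natl.
  have -> : sin (pi *+ k.+1) = 0 :> K.
    elim: (k.+1) => [|n IH]; first by rewrite mulr0n sin0.
    by rewrite mulrSr sinDpi IH oppr0.
  by rewrite mulr0.
- apply: continuous_subspaceT => t.
  apply: (@continuous_comp _ _ _ (fun s : K => s *+ k.+1) cos); last exact: continuous_cos.
  by apply: natmul_continuous.
- split.
  + by move=> t _; exact: ex_derive.
  + by apply: cvg_at_right_filter; exact: cF.
  + by apply: cvg_at_left_filter; exact: cF.
- by move=> t _; rewrite derive1E derive_val.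
Qed.

(** Pairing conjugate points removes the sine part. On the upper half circle alone that part would
    survive, since the integral of sin(kt) over [0, pi] is nonzero for odd k. *)
Lemma Re_monomial_cis_sym (c : C) k (t : K) :
  Re (c * cis t ^+ k) + Re (c * cis (- t) ^+ k) = 2 * Re c * cos (t *+ k).
Proof.
rewrite !cisX !ReM /cis mulNrn cosN sinN /= mulrN opprK addrACA addNr addr0.
by rewrite -mulrA mulr_natl mulr2n.
Qed.

Lemma circle_avg_monomial (c : C) k : circle_avg (fun z => Re (c * z ^+ k.+1)) = 0.
Proof.
rewrite /circle_avg.
transitivity ((2 * pi)^-1 * \int[mu]_(t in `[0, pi]) (2 * Re c * cos (t *+ k.+1 : K))).
  by congr (_ * _); apply: eq_Rintegral => t _; exact: Re_monomial_cis_sym.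
rewrite RintegralZl //; first by rewrite Rintegral_cos_mulrn !mulr0.
apply: continuous_integrable_0pi => t.
apply: (@continuous_comp _ _ _ (fun s : K => s *+ k.+1) cos); last exact: continuous_cos.
by apply: natmul_continuous.
Qed.

End CircleAverage.

(** * The reproducing-kernel bound for fractions with poles outside the disc *)

Section ReproducingBound.
Variable K : realType.
Local Notation C := K[i].
Local Notation Re := (@complex.Re K).
Implicit Types (L : seq C) (p : {poly C}) (z a : C).

Definition in_disc L := all (fun b => cmod b < 1) L.

Definition refl_poly L : {poly C} := \prod_(b <- L) (1 - b^*%C *: 'X).

Definition disc_frac p L z : C := p.[z] / (refl_poly L).[z].

Lemma refl_poly_cons a L z :
  (refl_poly (a :: L)).[z] = (1 - a^*%C * z) * (refl_poly L).[z].
Proof. by rewrite /refl_poly big_cons !hornerE. Qed.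

Lemma subr_conjM_neq0 a z : cmod a < 1 -> cmod z <= 1 -> 1 - a^*%C * z != 0.
Proof.
move=> a1 z1; rewrite subr_eq0; apply/eqP => e.
have := cmod1 K; rewrite e cmodM cmodJ => h.
have := cmod_ge0 a; have := cmod_ge0 z; nra.
Qed.

Lemma refl_poly_neq0 L z : in_disc L -> cmod z <= 1 -> (refl_poly L).[z] != 0.
Proof.
elim: L => [_ _|a L IH /= /andP[a1 L1] z1].
  by rewrite /refl_poly big_nil hornerC oner_neq0.
by rewrite refl_poly_cons mulf_neq0 ?IH // subr_conjM_neq0.
Qed.

Lemma size_refl_poly L : (size (refl_poly L) <= (size L).+1)%N.
Proof.
elim: L => [|a L IH]; first by rewrite /refl_poly big_nil size_poly1.
rewrite /refl_poly big_cons -/(refl_poly L) /=.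
apply: leq_trans (size_polyMleq _ _) _.
have : (size (1 - a^*%C *: 'X : {poly C})%R <= 2)%N.
  apply: leq_trans (size_polyD _ _) _; rewrite geq_max size_poly1 size_polyN /=.
  by apply: leq_trans (size_scale_leq _ _) _; rewrite size_polyX.
by move=> h; rewrite -subn1 leq_subLR; exact: leq_trans (leq_add h IH) _.
Qed.

Lemma continuousC_disc_frac p L : in_disc L -> continuousC (disc_frac p L \o @cis K).
Proof.
move=> L1; apply: continuousCM; first exact/continuousC_horner/continuousC_cis.
apply: continuousCV => [t|]; first by rewrite refl_poly_neq0 // cmod_cis.
exact/continuousC_horner/continuousC_cis.
Qed.

Lemma circle_cont_sqr_disc_frac p L : in_disc L ->
  circle_cont (fun z => cmod (disc_frac p L z) ^+ 2).
Proof. by move=> L1; exact: (continuous_sqr_cmod (continuousC_disc_frac p L1)). Qed.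

Lemma circle_cont_cmod_disc_frac p L : in_disc L ->
  circle_cont (fun z => cmod (disc_frac p L z)).
Proof. by move=> L1; exact: (continuous_cmod (continuousC_disc_frac p L1)). Qed.

Lemma circle_cont_Re_disc_frac p L : in_disc L ->
  circle_cont (fun z => Re (z * disc_frac p L z)).
Proof.
move=> L1; have [//] := continuousCM (@continuousC_cis K) (continuousC_disc_frac p L1).
Qed.

(** The free exponent [k] is what the induction needs: writing the polynomial as p X + c moves one
    factor z into the power in front of p. *)
Lemma circle_avg_horner p k : circle_avg (fun z => Re (z ^+ k.+1 * p.[z])) = 0.
Proof.
elim/poly_ind: p k => [|p c IH] k.
  rewrite (@eq_circle_avg _ _ (fun=> 0)) ?circle_avg_cst // => z _.
  by rewrite horner0 mulr0.
rewrite (@eq_circle_avg _ _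
  (fun z => Re (z ^+ k.+2 * p.[z]) + Re (c * z ^+ k.+1))); last first.
  move=> z _; rewrite -ReD hornerMXaddC mulrDr; congr (Re (_ + _)); last first.
    exact: mulrC.
  by rewrite [z ^+ k.+2]exprSr -mulrA [z * _]mulrC.
rewrite circle_avgD; first by rewrite IH circle_avg_monomial addr0.
  have := continuousC_horner ('X ^+ k.+2 * p) (@continuousC_cis K).
  by move=> [h _]; under eq_fun do rewrite -hornerXn -hornerM; exact: h.
have := continuousC_horner (c *: 'X ^+ k.+1) (@continuousC_cis K).
by move=> [h _]; under eq_fun do rewrite -hornerXn -hornerZ; exact: h.
Qed.

Lemma norm_circle_avg_le (u v : C -> K) : circle_cont u -> circle_cont v ->
  (forall z, cmod z = 1 -> `|u z| <= v z) -> `|circle_avg u| <= circle_avg v.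
Proof.
move=> cu cv uv; rewrite ler_norml; apply/andP; split; last first.
  by apply: le_circle_avg => // z z1; apply: le_trans (uv z z1); exact: ler_norm.
rewrite -mulN1r -circle_avgZ //; apply: le_circle_avg => //.
  by move=> t; apply: cvgM; [exact: cvg_cst | exact: cv].
move=> z z1; rewrite mulN1r lerNl; apply: le_trans (uv z z1).
by rewrite -normrN; exact: ler_norm.
Qed.

Lemma le0_of_geometric (r x B : K) : 0 <= r < 1 ->
  (forall n, x <= r ^+ n * B) -> x <= 0.
Proof.
move=> /andP[r0 r1] h.
have c : (fun n => r ^+ n * B) @ \oo --> (0 * B).
  by apply: cvgM; [apply: cvg_expr; rewrite ger0_norm | exact: cvg_cst].
rewrite mul0r in c; rewrite -(cvg_lim _ c) //; apply: limr_ge.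
  by apply/cvg_ex; exists 0.
by near=> n; exact: h.
Unshelve. all: by end_near.
Qed.

(* Mean value property at 0: expanding 1/(1 - conj a z) to the order M leaves a
   remainder of size |a|^M. *)
Lemma circle_avg_disc_frac p L : in_disc L ->
  circle_avg (fun z => Re (z * disc_frac p L z)) = 0.
Proof.
elim: L p => [p _|a L IH p /= /andP[a1 L1]].
  rewrite -(circle_avg_horner p 0); apply: eq_circle_avg => z _.
  by rewrite /disc_frac /refl_poly big_nil hornerC divr1 expr1.
have aL1 : in_disc (a :: L) by rewrite /= a1.
(* Split 1 = (1 - conj(a) z) + conj(a) z in the numerator. The first part cancels the new factor and
   has mean 0 by the induction hypothesis. *)
have step q : circle_avg (fun z => Re (z * disc_frac q (a :: L) z)) =
    circle_avg (fun z => Re (z * disc_frac (q * (a^*%C *: 'X)) (a :: L) z)).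
  rewrite -[RHS]add0r -(IH q L1) -circle_avgD; first last.
  - exact: circle_cont_Re_disc_frac.
  - exact: circle_cont_Re_disc_frac.
  apply: eq_circle_avg => z z1; rewrite -ReD /disc_frac refl_poly_cons.
  rewrite hornerM hornerZ hornerX; congr Re.
  have h1 : (refl_poly L).[z] != 0 by rewrite refl_poly_neq0 // z1.
  have h2 : 1 - a^*%C * z != 0 by rewrite subr_conjM_neq0 // z1.
  by field; rewrite h1 h2.
have iter n : circle_avg (fun z => Re (z * disc_frac p (a :: L) z)) =
    circle_avg (fun z => Re (z * disc_frac (p * (a^*%C *: 'X) ^+ n) (a :: L) z)).
  elim: n => [|n ->]; first by rewrite expr0 mulr1.
  by rewrite step exprSr mulrA.
apply/eqP; rewrite -normr_le0.
apply: (@le0_of_geometric (cmod a) _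
  (circle_avg (fun z => cmod (disc_frac p (a :: L) z)))).
  by rewrite cmod_ge0.
move=> n; rewrite (iter n) -circle_avgZ; last exact: circle_cont_cmod_disc_frac.
apply: norm_circle_avg_le; first exact: circle_cont_Re_disc_frac.
  by move=> t; apply: cvgM; [exact: cvg_cst | exact: circle_cont_cmod_disc_frac].
move=> z z1; apply: le_trans (ler_Re_cmod _) _.
rewrite /disc_frac hornerM horner_exp hornerZ hornerX.
by rewrite !cmodM !cmodX !cmodM cmodJ z1 mul1r mulr1 mulrAC mulrC.
Qed.

(** On the circle (1 - |a|^2) / |1 - conj(a) z|^2 is the Poisson kernel, equal to 1 + 2 Re (conj(a)
    z / (1 - conj(a) z)), and (z - a) / |1 - conj(a) z|^2 = z / (1 - conj(a) z). In this form both
    real parts are those of z times a fraction with its pole outside the disc (when h has the same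
    property), so they average to 0. *)
Lemma sqr_cmod_split a z (c h : C) : cmod a < 1 -> cmod z = 1 ->
  cmod ((c + (z - a) * h) / (1 - a^*%C * z)) ^+ 2 =
  cmod c ^+ 2 / (1 - cmod a ^+ 2) * (1 + 2 * Re (a^*%C * z / (1 - a^*%C * z)))
  + cmod h ^+ 2 + 2 * Re (c^*%C * h * z / (1 - a^*%C * z)).
Proof.
move=> a1 z1; have z0 : z != 0 by rewrite -cmod_gt0 z1.
have h2 : 1 - a^*%C * z != 0 by rewrite subr_conjM_neq0 // z1.
have h3 : 1 - a * a^*%C != 0.
  by rewrite mulrC subr_conjM_neq0 // ltW.
have h4 : z - a != 0.
  by rewrite subr_eq0; apply/eqP => e; move: a1; rewrite -e z1 ltxx.
apply: (fmorph_inj (real_complex K)).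
have morph (A B D X Y : K) : (A / (1 - B) * (1 + X) + D + Y)%:C =
    A%:C / (1 - B%:C) * (1 + X%:C) + D%:C + Y%:C.
  by rewrite !(rmorphD, rmorphM, rmorphN, fmorphV, rmorph1).
rewrite [RHS]morph [LHS]sqr_cmodC !sqr_cmodC -!addcJ_Re.
have conjM (x y : C) : (x * y)^*%C = x^*%C * y^*%C by exact: (rmorphM (@conjc K)).
have conjD (x y : C) : (x + y)^*%C = x^*%C + y^*%C by exact: (rmorphD (@conjc K)).
have conjB (x : C) : (- x)^*%C = - x^*%C by exact: (rmorphN (@conjc K)).
have conj1 : (1 : C)^*%C = 1 by exact: (rmorph1 (@conjc K)).
rewrite !(conjM, conjD, conjB, conj1, conjc_inv, conjcK) (unit_circle_conj z1).
by field; rewrite z0 h2 h3 /= h4.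
Qed.

Lemma cmod_unit_sub a z : cmod z = 1 -> cmod (1 - a^*%C * z) = cmod (z - a).
Proof.
move=> z1; rewrite -[RHS]cmodJ rmorphB /= (unit_circle_conj z1).
have z0 : z != 0 by rewrite -cmod_gt0 z1.
rewrite (_ : z^-1 - a^*%C = (1 - a^*%C * z) * z^-1); last by field.
by rewrite cmodM cmodV z1 invr1 mulr1.
Qed.

(** Cauchy-Schwarz for the vectors (sqrt s * k, sqrt S) and (x / sqrt s, sqrt N). In its use,
    [s * k ^+ 2] is the kernel part of the new pole, [S] the kernel of the remaining ones, and
    [x ^+ 2 / s] and [N] are the squared norms of the two orthogonal pieces. The proof avoids square
    roots by 4PQ <= (P + Q)^2. *)
Lemma cauchy_schwarz2 (x y k S N s : K) : 0 <= x -> 0 <= y -> 0 <= k ->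
  0 <= S -> 0 <= N -> 0 < s -> y ^+ 2 <= S * N ->
  (x * k + y) ^+ 2 <= (s * k ^+ 2 + S) * (x ^+ 2 / s + N).
Proof.
move=> x0 y0 k0 S0 N0 s0 h.
have e : (s * k ^+ 2 + S) * (x ^+ 2 / s + N) =
    (x * k) ^+ 2 + S * N + (s * k ^+ 2 * N + S * x ^+ 2 / s).
  by field; rewrite gt_eqF.
rewrite e sqrrD; set P := s * k ^+ 2 * N; set Q := S * x ^+ 2 / s.
suff : 2 * (x * k * y) <= P + Q by rewrite mulr_natl; lra.
have P0 : 0 <= P by rewrite /P !mulr_ge0 ?exprn_ge0 // ltW.
have Q0 : 0 <= Q by rewrite /Q divr_ge0 ?mulr_ge0 ?exprn_ge0 // ltW.
have xk0 : 0 <= 2 * (x * k * y) by rewrite !mulr_ge0.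
rewrite -(@ler_sqr K) ?nnegrE ?addr_ge0 //.
have -> : (P + Q) ^+ 2 = (P - Q) ^+ 2 + 4 * (x * k) ^+ 2 * (S * N).
  by rewrite /P /Q; field; rewrite gt_eqF.
have -> : (2 * (x * k * y)) ^+ 2 = 4 * (x * k) ^+ 2 * y ^+ 2 by ring.
apply: ler_wpDl; first exact: sqr_ge0.
by rewrite ler_wpM2l // mulr_ge0 // sqr_ge0.
Qed.

Definition poisson_sum L z : K :=
  \sum_(b <- L) (1 - cmod b ^+ 2) / cmod (z - b) ^+ 2.

Lemma poisson_sum_ge0 L z : in_disc L -> 0 <= poisson_sum L z.
Proof.
elim: L => [_|a L IH /= /andP[a1 /IH L1]]; rewrite /poisson_sum ?big_nil // big_cons.
apply: addr_ge0 => //; rewrite divr_ge0 ?sqr_ge0 //.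
by have := cmod_ge0 a; nra.
Qed.

(* [1 + poisson_sum L z] is the value on the diagonal of the reproducing kernel
   of the fractions [disc_frac p L] with [deg p <= size L]; removing the pole
   [1 / conj a] splits such a fraction orthogonally. *)
Theorem disc_frac_bound p L z : in_disc L -> (size p <= (size L).+1)%N ->
  cmod z = 1 ->
  cmod (disc_frac p L z) ^+ 2 <=
  (1 + poisson_sum L z) * circle_avg (fun w => cmod (disc_frac p L w) ^+ 2).
Proof.
elim: L p => [|a L IH] p /=.
  move=> _ /size1_polyC -> z1; rewrite /poisson_sum big_nil addr0 mul1r.
  rewrite (@eq_circle_avg _ _ (fun=> cmod (disc_frac (p`_0)%:P [::] z) ^+ 2)).
    by rewrite circle_avg_cst.
  by move=> w _; rewrite /disc_frac /refl_poly big_nil !hornerC.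
move=> /andP[a1 L1] sp z1.
have aL1 : in_disc (a :: L) by rewrite /= a1.
(* This value makes [p - c *: refl_poly L] vanish at a. The quotient [q] by X - a then has one
   degree less, as the induction hypothesis for L requires. *)
pose c := p.[a] / (refl_poly L).[a].
have : root (p - c *: refl_poly L) a.
  rewrite rootE !hornerE /c divfK ?subrr // refl_poly_neq0 //; exact: ltW.
move=> /factor_theorem[q pq].
have pE : p = c *: refl_poly L + q * ('X - a%:P) by rewrite -pq addrC subrK.
have sq : (size q <= (size L).+1)%N.
  have : (size (q * ('X - a%:P))%R <= (size L).+2)%N.
    rewrite -pq; apply: leq_trans (size_polyD _ _) _; rewrite geq_max sp size_polyN /=.
    apply: leq_trans (size_scale_leq _ _) _.
    exact: leq_trans (size_refl_poly _) _.
  have [->|q0] := eqVneq q 0; first by rewrite size_poly0.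
  by rewrite size_Mmonic ?monicXsubC // size_XsubC addn2.
have {}IH := IH q L1 sq z1.
set s := 1 - cmod a ^+ 2.
have s0 : 0 < s by rewrite /s; have := cmod_ge0 a; nra.
have HE w : cmod w = 1 -> disc_frac p (a :: L) w =
    (c + (w - a) * disc_frac q L w) / (1 - a^*%C * w).
  move=> w1; rewrite /disc_frac refl_poly_cons {1}pE hornerD hornerZ hornerM hornerXsubC.
  have h1 : (refl_poly L).[w] != 0 by rewrite refl_poly_neq0 // w1.
  have h2 : 1 - a^*%C * w != 0 by rewrite subr_conjM_neq0 // w1.
  by field; rewrite h1 h2.
have avgE : circle_avg (fun w => cmod (disc_frac p (a :: L) w) ^+ 2) =
    cmod c ^+ 2 / s + circle_avg (fun w => cmod (disc_frac q L w) ^+ 2).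
  have a1' : in_disc [:: a] by rewrite /= a1.
  pose f1 (w : C) : K := Re (w * disc_frac (a^*%C)%:P [:: a] w).
  pose f2 (w : C) : K := Re (w * disc_frac (c^*%C *: q) (a :: L) w).
  have cf1 : circle_cont f1 by exact: circle_cont_Re_disc_frac.
  have cf2 : circle_cont f2 by exact: circle_cont_Re_disc_frac.
  have cZ (k : K) (u : C -> K) : circle_cont u -> circle_cont (fun w => k * u w).
    by move=> cu t; apply: cvgM; [exact: cvg_cst | exact: cu].
  have cD (u v : C -> K) : circle_cont u -> circle_cont v -> circle_cont (fun w => u w + v w).
    by move=> cu cv t; apply: cvgD; [exact: cu | exact: cv].
  have cc (k : K) : circle_cont (fun=> k : K) by move=> t; exact: cvg_cst.
  rewrite (@eq_circle_avg _ _ (fun w => (cmod c ^+ 2 / s + cmod c ^+ 2 / s * 2 * f1 w)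
    + cmod (disc_frac q L w) ^+ 2 + 2 * f2 w)); last first.
    move=> w w1; rewrite HE // sqr_cmod_split // -/s.
    have h1 : (refl_poly L).[w] != 0 by rewrite refl_poly_neq0 // w1.
    have h2 : 1 - a^*%C * w != 0 by rewrite subr_conjM_neq0 // w1.
    have -> : f1 w = Re (a^*%C * w / (1 - a^*%C * w)).
      rewrite /f1; congr Re.
      by rewrite /disc_frac refl_poly_cons /refl_poly big_nil !hornerC; field.
    have -> : f2 w = Re (c^*%C * disc_frac q L w * w / (1 - a^*%C * w)).
      rewrite /f2; congr Re.
      by rewrite /disc_frac refl_poly_cons hornerZ; field; rewrite h1 h2.
    by rewrite mulrDr mulr1 !mulrA.
  have cg : circle_cont (fun w => cmod (disc_frac q L w) ^+ 2).
    exact: circle_cont_sqr_disc_frac.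
  have c0 := cc (cmod c ^+ 2 / s).
  have c1 := cZ (cmod c ^+ 2 / s * 2) _ cf1.
  have c2 := cD _ _ c0 c1.
  rewrite (circle_avgD (cD _ _ c2 cg) (cZ 2 _ cf2)) (circle_avgD c2 cg).
  rewrite (circle_avgD c0 c1) (circle_avgZ _ cf1) (circle_avgZ _ cf2).
  by rewrite circle_avg_cst !circle_avg_disc_frac // !mulr0 !addr0.
rewrite avgE HE // cmodM cmodV.
have h2 : 0 < cmod (1 - a^*%C * z) by rewrite cmod_gt0 subr_conjM_neq0 // z1.
set k := (cmod (1 - a^*%C * z))^-1.
have k0 : 0 < k by rewrite invr_gt0.
(* The new Poisson summand is s k^2 because |1 - conj(a) z| = |z - a| on the circle. *)
have -> : 1 + poisson_sum (a :: L) z = s * k ^+ 2 + (1 + poisson_sum L z).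
  by rewrite /poisson_sum big_cons addrCA /k cmod_unit_sub // exprVn.
have N0 : 0 <= circle_avg (fun w => cmod (disc_frac q L w) ^+ 2).
  by apply: circle_avg_ge0 => w _; exact: sqr_ge0.
apply: le_trans (cauchy_schwarz2 (cmod_ge0 c) (cmod_ge0 (disc_frac q L z)) (ltW k0)
  _ N0 s0 IH); last first.
  by rewrite addr_ge0 // poisson_sum_ge0.
rewrite ler_sqr ?nnegrE ?addr_ge0 ?mulr_ge0 ?cmod_ge0 ?(ltW k0) //.
apply: le_trans (ler_wpM2r (ltW k0) (cmodD _ _)) _.
rewrite mulrDl lerD2l cmodM -(cmod_unit_sub _ z1) mulrAC /k mulfV ?mul1r //.
by rewrite gt_eqF.
Qed.

End ReproducingBound.

(** * The substitution x = cos t *)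

Section ChebyshevSubstitution.
Variable K : realType.
Local Notation mu := (@lebesgue_measure K).
Implicit Types (g : K -> K).

Lemma derive1_cos : derive1 (@cos K) = (fun x => - sin x).
Proof. by apply/funext => x; rewrite derive1E derive_val. Qed.

Lemma continuous_omega (x : K) : -1 < x < 1 -> {for x, continuous (@omega K)}.
Proof.
move=> x1; apply: cvgV.
  by rewrite sqrtr_eq0 -ltNge subr_gt0; nra.
apply: (@continuous_comp _ _ _ (fun y : K => 1 - y ^+ 2) Num.sqrt).
  by apply: cvgB; [exact: cvg_cst | exact: exprn_continuous].
exact: sqrt_continuous.
Qed.

Lemma omega_ge0 (x : K) : 0 <= omega x.
Proof. by rewrite invr_ge0 sqrtr_ge0. Qed.

Lemma measurable_omega : measurable_fun (@segI K) (@omega K).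
Proof.
apply: (@measurable_fun_itv_cc _ _ _ false true).
apply: open_continuous_measurable_fun; first exact: interval_open.
by move=> x; rewrite inE /= in_itv /=; exact: continuous_omega.
Qed.

Lemma measurable_mul_omega g : measurable_fun (@segI K) g ->
  measurable_fun (@segI K) (fun x => (g x * omega x)%:E).
Proof.
by move=> mg; apply/measurable_EFinP/measurable_funM; [|exact: measurable_omega].
Qed.

Lemma measurable_segI_continuous g : {within (@segI K), continuous g} ->
  measurable_fun (@segI K) g.
Proof. by apply: subspace_continuous_measurable_fun; exact: measurable_itv. Qed.

(** The weight is singular at the endpoints, so the substitution is made on compact intervals [a, b]
    inside ]0, pi[. There omega (cos t) = 1 / sin t cancels the derivative of cos. Since g >= 0, the
    image [cos b, cos a] may be enlarged to [-1, 1], and monotone convergence exhausts ]0, pi[. *)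
Lemma integral_cos_le_omega g : {within (@segI K), continuous g} ->
  (forall x, segI x -> 0 <= g x) ->
  (\int[mu]_(t in `[0%R, pi]) (g (cos t))%:E <=
   \int[mu]_(x in (@segI K)) (g x * omega x)%:E)%E.
Proof.
move=> cg g0.
have segcos t : segI (cos t : K) by rewrite /segI /= in_itv /= cos_geN1 cos_le1.
have mgcos (D : set K) : measurable D -> measurable_fun D (fun t => (g (cos t))%:E).
  move=> mD; apply/measurable_EFinP.
  apply: (@measurable_comp _ _ _ _ _ _ (@segI K)) => //.
  - exact: measurable_itv.
  - by move=> _ [t _ <-]; exact: segcos.
  - by apply: subspace_continuous_measurable_fun => //; exact: measurable_itv.
  - apply: measurable_funTS; apply: continuous_measurable_fun.
    exact: continuous_cos.
pose F n : set K := `[n.+1%:R^-1, pi - n.+1%:R^-1]%classic.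
have inv1 n : 0 < (n.+1%:R^-1 : K) <= 1.
  by rewrite invr_gt0 ltr0Sn invf_le1 ?ler1n ?ltr0Sn.
(* Ensures 1/(n+1) <= pi - 1/(n+1) already for n = 0, so that every [F n] is a genuine interval. *)
have pi2 := pi_ge2 K.
have Foo n t : F n t -> 0 < t < pi.
  by rewrite /F /= in_itv /=; have := inv1 n; move: (n.+1%:R^-1) => e; lra.
have FE : \bigcup_n F n = `]0, pi[%classic.
  apply/seteqP; split=> [t [n _ Fnt]|t]; first by rewrite /= in_itv /=; exact: Foo Fnt.
  rewrite /= in_itv /= => /andP[t0 tpi].
  have t1 : 0 < Num.min t (pi - t) by rewrite lt_min t0 subr_gt0.
  have [n] := ltr_add_invr t1; rewrite add0r lt_min => /andP[n1 n2].
  by exists n => //; rewrite /F /= in_itv /=; move: (n.+1%:R^-1) n1 n2 => e; lra.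
have ndF : {homo F : n m / (n <= m)%N >-> (n <= m)%O}.
  move=> n m nm; rewrite subsetEset => t; rewrite /F /= !in_itv /=.
  have : m.+1%:R^-1 <= n.+1%:R^-1 :> K by rewrite lef_pV2 ?posrE ?ltr0Sn // ler_nat.
  by move: (n.+1%:R^-1) (m.+1%:R^-1) => e e'; lra.
have mF n : measurable (F n) by exact: measurable_itv.
rewrite (@integral_itv_bndoo _ _ _ _ true false); last exact: mgcos.
have cvgF : (\int[mu]_(t in F n) (g (cos t))%:E)%E @[n --> \oo] -->
    (\int[mu]_(t in `]0%R, pi[) (g (cos t))%:E)%E.
  rewrite -FE; apply: ge0_nondecreasing_set_cvg_integral => //.
  - by move=> n; exact: mgcos.
  - by move=> n t _; rewrite lee_fin g0.
rewrite -(cvg_lim _ cvgF) //; apply: lime_le; first by apply/cvg_ex; eexists; exact: cvgF.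
near=> n.
pose a : K := n.+1%:R^-1; pose b : K := pi - n.+1%:R^-1.
have ab : a <= b by rewrite /a /b; have := inv1 n; move: (n.+1%:R^-1) => e; lra.
have ab0 : 0 < a /\ b < pi by rewrite /a /b; have := inv1 n; move: (n.+1%:R^-1) => e; lra.
have sin0 (t : K) : 0 < t < pi -> 0 < sin t by exact: sin_gt0_pi.
have cos11 (t : K) : 0 < t < pi -> -1 < cos t < 1.
  move=> /sin0 st; have := cos2Dsin2 t; nra.
have cosab x : x \in `[cos b, cos a] -> -1 < x < 1.
  rewrite in_itv /= => /andP[bx xa].
  have [a0 b0] := ab0.
  by move: (cos11 a) (cos11 b); rewrite a0 b0 (le_lt_trans ab b0) (lt_le_trans a0 ab); lra.
have tab t : t \in `[a, b] -> 0 < t < pi by rewrite in_itv /=; lra.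
pose G x := g x * omega x.
have GE t : t \in `[a, b] -> ((G \o cos) * - derive1 (@cos K)) t = g (cos t).
  move=> /tab tp; have st := sin0 _ tp; rewrite derive1_cos.
  transitivity (g (cos t) * (Num.sqrt (1 - cos t ^+ 2))^-1 * - - sin t) => //.
  rewrite -sin2cos2 sqrtr_sqr ger0_norm ?(ltW st) // opprK -mulrA mulVf ?mulr1 //.
  by rewrite gt_eqF.
rewrite (_ : (\int[mu]_(x in F n) _ = \int[mu]_(x in `[a, b])
    (((G \o cos) * - derive1 (@cos K)) x)%:E)%E); last first.
  by apply: eq_integral => t; rewrite inE => tF; rewrite GE.
rewrite -integration_by_substitution_decreasing //.
- apply: ge0_subset_integral => //.
  + exact: measurable_itv.
  + exact: (measurable_mul_omega (measurable_segI_continuous cg)).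
  + by move=> x xI; rewrite lee_fin mulr_ge0 ?omega_ge0 // g0.
  + by move=> x /cosab; rewrite /segI /= in_itv /=; lra.
- move=> x y /tab x0 /tab y0 xy; rewrite ltr_cos //.
  + by rewrite in_itv /=; lra.
  + by rewrite in_itv /=; lra.
- move=> t _; rewrite derive1_cos; apply: cvgN; exact: continuous_sin.
- rewrite derive1_cos; apply/cvg_ex; exists (- sin a).
  by apply: cvg_at_right_filter; apply: cvgN; exact: continuous_sin.
- rewrite derive1_cos; apply/cvg_ex; exists (- sin b).
  by apply: cvg_at_left_filter; apply: cvgN; exact: continuous_sin.
- split.
  + by move=> t _; exact: derivable_cos.
  + by apply: cvg_at_right_filter; exact: continuous_cos.
  + by apply: cvg_at_left_filter; exact: continuous_cos.
- have cg' : {within `[cos b, cos a], continuous g}.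
    apply: continuous_subspaceW cg => x /cosab.
    by rewrite /segI /= in_itv /=; lra.
  have co : {within `[cos b, cos a], continuous (@omega K)}.
    by apply: continuous_in_subspaceT => x; rewrite inE /= => /cosab; exact: continuous_omega.
  by move=> x; apply: cvgM; [exact: cg' | exact: co].
Unshelve. all: by end_near.
Qed.

End ChebyshevSubstitution.

(** * Poles of rational functions and of their composite with the Joukowski map *)

Section RationalFunctions.
Variable F : fieldType.
Implicit Types (f : {fraction {poly F}}) (p : {poly F}).
Local Notation tofrac := (@FracField.tofrac {poly F}).

Lemma fracE f : f = tofrac (frac (repr f)).1 / tofrac (frac (repr f)).2.
Proof.
have d0 : (frac (repr f)).2 != 0 by exact: denom_ratioP.
have td0 : tofrac (frac (repr f)).2 != 0 by rewrite tofrac_eq0.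
apply: (mulIf td0); rewrite divfK // -{1}[f]reprK.
unlock FracField.tofrac; rewrite -[LHS]FracField.pi_mul.
apply/eqP; rewrite FracField.equivf_def /FracField.mulf /=.
by rewrite !numden_Ratio ?mulf_neq0 ?oner_neq0 //; apply/eqP; ring.
Qed.

Lemma rden_neq0 f : rden f != 0.
Proof.
have d0 : (frac (repr f)).2 != 0 by exact: denom_ratioP.
rewrite /rden; apply: contraNneq d0 => e.
by rewrite -(divpK (dvdp_gcdr (frac (repr f)).1 (frac (repr f)).2)) e mul0r.
Qed.

Lemma coprimep_rnum_rden f : coprimep (rnum f) (rden f).
Proof. by rewrite coprimep_div_gcd // denom_ratioP orbT. Qed.

Lemma rnum_rdenE f : f = tofrac (rnum f) / tofrac (rden f).
Proof.
rewrite [LHS]fracE /rnum /rden; set r := frac (repr f).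
have d0 : r.2 != 0 by exact: denom_ratioP.
set d := gcdp r.1 r.2.
have d1 : d != 0 by rewrite gcdp_eq0 negb_and d0 orbT.
have td0 : tofrac d != 0 by rewrite tofrac_eq0.
have e1 : r.1 %/ d * d = r.1 by rewrite divpK ?dvdp_gcdl.
have e2 : r.2 %/ d * d = r.2 by rewrite divpK ?dvdp_gcdr.
by rewrite -[in LHS]e1 -[in LHS]e2 !rmorphM invfM mulrACA divff ?mulr1.
Qed.

(** Passes from sums over a set weighted by multiplicity, as in the degree and in [mu0], to sums
    over a list with repetitions, on which induction is possible. *)
Lemma big_fsbig_count (R : nmodType) (T : choiceType) (S : seq T) (A : set T)
    (G : T -> R) : (forall a, a \in S -> A a) ->
  \sum_(a \in A) G a *+ count_mem a S = \sum_(a <- S) G a.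
Proof.
move=> SA.
rewrite -(@fsbig_widen _ _ _ _ [set` undup S]) /=.
- rewrite -fsbig_seq ?undup_uniq // -[RHS](@big_undup_iterop_count _ _ _ _ _ xpredT).
  apply: eq_bigr => a _; rewrite Monoid.iteropE.
  by elim: count => [|n IH] //=; rewrite ?mulr0n // mulrS IH.
- by move=> a /=; rewrite mem_undup; exact: SA.
- by move=> a [_ /= /negP]; rewrite mem_undup => /count_memPn ->; rewrite mulr0n.
Qed.

End RationalFunctions.

(** * Clearing denominators in R((z + 1/z)/2) *)

Section JoukowskiSubstitution.
Variable F : fieldType.
Hypothesis two_neq0 : (2 : F) != 0.
Implicit Types (f : {fraction {poly F}}) (p : {poly F}).
Local Notation tofrac := (@FracField.tofrac {poly F}).

(* The polynomial [(2 z)^k p ((z + 1 / z) / 2)]; [k - i] is not truncated as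
   long as [size p <= k.+1]. *)
Definition joukowski_num k p : {poly F} :=
  \sum_(i < size p) p`_i *: (('X^2 + 1) ^+ i * (2 *: 'X) ^+ (k - i)).

Lemma joukowski_scale (E : fieldType) (x : E) : (2 : E) != 0 -> x != 0 ->
  2^-1 * (x + x^-1) * (2 * x) = x * x + 1.
Proof. by move=> h2 x0; field; rewrite x0 h2. Qed.

Lemma cross_mul_eq (E : fieldType) (a b p q w : E) : b != 0 -> q != 0 ->
  a / b = p / q -> p * (b * w) = a * w * q.
Proof.
by move=> b0 q0 e; rewrite -[a](divfK b0) e; field.
Qed.

(** Homogenisation, used with j = (z + 1/z)/2, w = 2z and u = z^2 + 1. The ring is arbitrary because
    z is once a number and once the indeterminate in the field of fractions. *)
Lemma sum_scale_exp (R : comNzRingType) n k (c : nat -> R) (j u w : R) :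
  (n <= k.+1)%N -> j * w = u ->
  (\sum_(i < n) c i * j ^+ i) * w ^+ k =
  \sum_(i < n) c i * (u ^+ i * w ^+ (k - i)).
Proof.
move=> nk <-; rewrite mulr_suml; apply: eq_bigr => i _.
have ik : (i <= k)%N by rewrite -ltnS (leq_trans (ltn_ord i)).
by rewrite exprMn -{1}(subnKC ik) exprD !mulrA.
Qed.

Lemma horner_joukowski_num k p (z : F) : (size p <= k.+1)%N -> z != 0 ->
  (joukowski_num k p).[z] = p.[2^-1 * (z + z^-1)] * (2 * z) ^+ k.
Proof.
move=> pk z0; rewrite [p.[_]]horner_coef.
rewrite (@sum_scale_exp _ _ k (fun i => p`_i) _ (z ^+ 2 + 1) (2 * z)) //; last first.
  by field; rewrite z0 two_neq0.
rewrite /joukowski_num horner_sum; apply: eq_bigr => i _.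
by rewrite hornerZ hornerM !horner_exp hornerD hornerXn hornerC hornerZ hornerX.
Qed.

Lemma lift_frac_joukowski k p : (size p <= k.+1)%N ->
  (lift_frac p).[joukowski F] * tofrac (2 *: 'X) ^+ k = tofrac (joukowski_num k p).
Proof.
move=> pk; rewrite /lift_frac /map_poly horner_poly.
have X0 : tofrac 'X != 0 by rewrite tofrac_eq0 polyX_eq0.
have E2 : tofrac (2%:P) = 2 by rewrite polyC_natr rmorph_nat.
have t0 : tofrac (2%:P) != 0 by rewrite tofrac_eq0 polyC_eq0.
rewrite (@sum_scale_exp _ _ k (fun i => tofrac (p`_i)%:P) _ (tofrac ('X^2 + 1))) //.
  rewrite /joukowski_num rmorph_sum; apply: eq_bigr => i _.
  by rewrite -[in RHS](mul_polyC p`_i) /= !tofracM !tofracXn.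
rewrite /joukowski -mul_polyC tofracD !tofracM tofrac1 E2.
have two0 : (2 : {fraction {poly F}}) != 0 by rewrite -E2.
have := joukowski_scale two0 X0.
by set x := tofrac 'X => h; exact h.
Qed.

Lemma size_joukowski_num k p : (size p <= k.+1)%N ->
  (size (joukowski_num k p) <= (2 * k).+1)%N.
Proof.
move=> pk; apply: leq_trans (size_sum _ _ _) _; apply/bigmax_leqP => i _.
have ik : (i <= k)%N by rewrite -ltnS (leq_trans (ltn_ord i)).
apply: leq_trans (size_scale_leq _ _) _.
apply: leq_trans (size_polyMleq _ _) _.
have h1 : (size (('X^2 + 1 : {poly F})^+ i)%R <= (2 * i).+1)%N.
  apply: leq_trans (size_poly_exp_leq _ _) _.
  by rewrite size_polyDl ?size_polyXn ?size_poly1.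
have h2 : (size ((2 *: 'X : {poly F})^+ (k - i))%R <= (k - i).+1)%N.
  apply: leq_trans (size_poly_exp_leq _ _) _.
  by rewrite size_scale // size_polyX mul1n.
rewrite -subn1 leq_subLR; apply: leq_trans (leq_add h1 h2) _.
rewrite addSn addnS add1n ltnS ltnS mul2n -addnn -addnA subnKC //.
by rewrite mul2n -addnn leq_add2r.
Qed.

(** The lowest terms of the composite are not explicit. This polynomial identity, together with the
    coprimality of [rnum] and [rden], replaces them: zeros, values and degrees of the composite are
    all read off it. Using the same [k] for numerator and denominator makes the powers of 2z
    cancel. *)
Lemma rcomp_joukowskiE f k : (size (rnum f) <= k.+1)%N ->
  (size (rden f) <= k.+1)%N -> joukowski_num k (rden f) != 0 ->
  rnum (rcomp f (joukowski F)) * joukowski_num k (rden f) =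
  joukowski_num k (rnum f) * rden (rcomp f (joukowski F)).
Proof.
move=> nk dk d0; apply/eqP; rewrite -tofrac_eq !tofracM.
rewrite -!lift_frac_joukowski //; set g := rcomp f _.
have Qn0 : tofrac (rden g) != 0 by rewrite tofrac_eq0 rden_neq0.
have : tofrac (joukowski_num k (rden f)) != 0 by rewrite tofrac_eq0.
rewrite -lift_frac_joukowski // mulf_eq0 negb_or => /andP[B0 W0].
by apply/eqP; exact (cross_mul_eq _ B0 Qn0 (rnum_rdenE g)).
Qed.

End JoukowskiSubstitution.

(** * Poles listed with repetition and reflected into the unit disc *)

Section PoleList.
Variable K : realType.
Local Notation C := K[i].
Implicit Types (g f : {fraction {poly C}}) (z a : C) (S : seq (option C)).

Definition den_roots g : seq C := sval (closed_field_poly_normal (rden g)).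

Lemma rden_factor g :
  rden g = lead_coef (rden g) *: \prod_(a <- den_roots g) ('X - a%:P).
Proof. exact: (svalP (closed_field_poly_normal (rden g))). Qed.

(** Each pole is repeated according to its multiplicity, including the one at infinity, so the
    length is the larger of the two degrees. *)
Definition pole_seq g : seq (option C) :=
  map Some (den_roots g)
  ++ nseq ((size (rnum g)).-1 - (size (rden g)).-1) None.

Lemma pole_multE g o : pole_mult g o = count_mem o (pole_seq g).
Proof.
have l0 : lead_coef (rden g) != 0 by rewrite lead_coef_eq0 rden_neq0.
rewrite count_cat count_map count_nseq; case: o => [a|] /=.
  rewrite mul0n addn0 rden_factor -mul_polyC mupMr ?rootC // mu_prod_XsubC.
  by apply: eq_count => b /=.
by rewrite mul1n (@eq_count _ _ pred0) ?count_pred0.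
Qed.

Lemma size_den_roots g : size (den_roots g) = (size (rden g)).-1.
Proof.
rewrite [in RHS]rden_factor size_scale ?lead_coef_eq0 ?rden_neq0 //.
by rewrite size_prod_XsubC.
Qed.

Lemma size_pole_seq g :
  size (pole_seq g) = maxn (size (rden g)).-1 (size (rnum g)).-1.
Proof. by rewrite size_cat size_map size_nseq size_den_roots maxnE. Qed.

Lemma rdegreeE g : rdegree g = size (pole_seq g).
Proof.
rewrite /rdegree -sum1_size -(@big_fsbig_count _ _ (pole_seq g) setT) //.
apply: eq_fsbigr => o _; rewrite pole_multE.
by elim: count => // k IH; rewrite mulrS -IH.
Qed.

Lemma mem_den_roots g a : (a \in den_roots g) = root (rden g) a.
Proof.
rewrite rden_factor rootZ ?lead_coef_eq0 ?rden_neq0 //.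
by rewrite root_prod_XsubC.
Qed.

Lemma is_pole_root g a : is_pole g (Some a) = root (rden g) a.
Proof.
by rewrite /is_pole /= -XsubC_dvd ?rden_neq0 // dvdp_XsubCl.
Qed.

(** Infinity goes to 0, in accordance with the convention that the reflection of 0 is infinity. *)
Definition into_disc (o : option C) : C :=
  if o is Some a then (if cmod a < 1 then a else (a^*%C)^-1) else 0.

Lemma reflect_ptE z : reflect_pt z = if z == 0 then None else Some (z^*%C)^-1.
Proof. by []. Qed.

Lemma cmod_into_disc o : (if o is Some a then cmod a != 1 else true) ->
  cmod (into_disc o) < 1.
Proof.
case: o => [a|]; rewrite /into_disc; last by rewrite cmod0.
move=> a1; case: (ltP (cmod a) 1) => // a1'.
by rewrite cmodV cmodJ invf_lt1 ?(lt_le_trans ltr01) // lt_def a1.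
Qed.

(** The fibre of [into_disc] over z consists of z and its reflection, which are distinct because one
    lies inside and the other outside the circle. Summed over a list of poles, this is the count
    without cancellation that defines [cR_mult]. *)
Lemma into_disc_eq o z : cmod z < 1 -> (if o is Some a then cmod a != 1 else true) ->
  (into_disc o == z : nat) = ((o == Some z) + (o == reflect_pt z))%N.
Proof.
move=> z1; rewrite reflect_ptE; case: o => [a|] /=; last first.
  by move=> _; rewrite eq_sym; case: eqP.
move=> a1; have [a1'|a1'] := ltP (cmod a) 1.
  have -> : (Some a == (if z == 0 then None else Some (z^*%C)^-1)) = false.
    case: (z =P 0) => // z0; apply/negbTE/eqP => -[e].
    move: a1'; rewrite e cmodV cmodJ; apply/negP; rewrite -leNgt.
    by rewrite invf_ge1 ?(ltW z1) // cmod_gt0; apply/eqP.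
  by rewrite addn0.
have -> : (Some a == Some z) = false.
  by apply/negbTE/eqP => -[e]; move: a1'; rewrite e leNgt z1.
have a0 : a != 0 by rewrite -cmod_gt0 (lt_le_trans _ a1').
rewrite add0n; congr nat_of_bool; have [->|z0] := eqVneq z 0.
  by rewrite invr_eq0 conjc_eq0 (negbTE a0).
by apply/eqP/eqP => [<-|[->]]; rewrite conjc_inv conjcK invrK.
Qed.

Lemma count_into_disc S z : cmod z < 1 ->
  all (fun o => if o is Some a then cmod a != 1 else true) S ->
  count_mem z (map into_disc S) =
  (count_mem (Some z) S + count_mem (reflect_pt z) S)%N.
Proof.
move=> z1; elim: S => //= o S IH /andP[hd tl].
by rewrite IH // into_disc_eq // addnACA.
Qed.

Lemma horner_refl_poly (L : seq C) z :
  (refl_poly L).[z] = \prod_(b <- L) (1 - b^*%C * z).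
Proof.
by rewrite /refl_poly horner_prod; apply: eq_bigr => b _; rewrite !hornerE.
Qed.

(** The constant ratio of |z - a| to |1 - conj(b) z| on the circle, b being a moved into the
    disc. *)
Definition circle_scale (a : C) : K := if cmod a < 1 then 1 else cmod a.

Lemma cmod_sub_into_disc a z : cmod z = 1 ->
  cmod (z - a) = circle_scale a * cmod (1 - (into_disc (Some a))^*%C * z).
Proof.
move=> z1; rewrite /circle_scale /=; case: ltP => a1.
  by rewrite mul1r cmod_unit_sub.
have a0 : a != 0 by rewrite -cmod_gt0 (lt_le_trans _ a1).
rewrite -cmodM conjc_inv conjcK.
by rewrite mulrBr mulr1 mulrA mulfV // mul1r cmodB.
Qed.

Lemma circle_scale_gt0 a : 0 < circle_scale a.
Proof.
by rewrite /circle_scale; case: (ltP (cmod a) 1) => // /(lt_le_trans ltr01).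
Qed.

Lemma cmod_rden_circle g z : cmod z = 1 ->
  cmod (rden g).[z] = cmod (lead_coef (rden g)) *
    \prod_(a <- den_roots g) circle_scale a *
    cmod (refl_poly (map into_disc (pole_seq g))).[z].
Proof.
move=> z1; rewrite [in LHS]rden_factor hornerZ cmodM -mulrA; congr (_ * _).
rewrite horner_prod cmod_prod horner_refl_poly cmod_prod big_map big_cat /= big_map.
(* Poles at infinity are moved to b = 0, whose factor 1 - conj(b) z is 1. *)
rewrite [X in _ * (_ * X)]big1_seq ?mulr1; last first.
  move=> o /andP[_ /nseqP[-> _]]; rewrite /into_disc.
  by rewrite (rmorph0 (@conjc K)) mul0r subr0 cmod1.
rewrite -big_split /=; apply: eq_bigr => a _.
by rewrite hornerXsubC cmod_sub_into_disc.
Qed.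

Lemma all_pole_seq_circle g : (forall z, cmod z = 1 -> ~~ root (rden g) z) ->
  all (fun o => if o is Some a then cmod a != 1 else true) (pole_seq g).
Proof.
move=> h; rewrite all_cat all_map all_nseq orbT andbT.
apply/allP => a; rewrite mem_den_roots /= => ra.
by apply/eqP => a1; have := h a a1; rewrite ra.
Qed.

Definition disc_poles g : seq C := map into_disc (pole_seq g).

Lemma in_disc_poles g : (forall z, cmod z = 1 -> ~~ root (rden g) z) ->
  in_disc (disc_poles g).
Proof.
move=> /all_pole_seq_circle h; rewrite /in_disc all_map; apply: sub_all h.
by move=> o; exact: cmod_into_disc.
Qed.

(** Only the denominator changes, up to a constant modulus absorbed into [p]. The degree of the
    numerator stays within the bound even when it exceeds that of the denominator, since the poles
    at infinity count in the list. *)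
Lemma cmod_reval_circle g : (forall z, cmod z = 1 -> ~~ root (rden g) z) ->
  exists p : {poly C}, (size p <= (size (disc_poles g)).+1)%N /\
    forall z, cmod z = 1 -> cmod (reval g z) = cmod (disc_frac p (disc_poles g) z).
Proof.
move=> h; set k := cmod (lead_coef (rden g)) * \prod_(a <- den_roots g) circle_scale a.
have k0 : 0 < k.
  rewrite mulr_gt0 ?cmod_gt0 ?lead_coef_eq0 ?rden_neq0 // prodr_gt0 // => a _.
  exact: circle_scale_gt0.
exists (k^-1%:C *: rnum g); split.
  apply: leq_trans (size_scale_leq _ _) _; rewrite size_map size_pole_seq.
  by apply: leq_trans (leqSpred _) _; rewrite ltnS leq_maxr.
move=> z z1; rewrite /disc_frac hornerZ !cmodM !cmodV cmod_rden_circle //.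
by rewrite cmod_real ger0_norm ?invr_ge0 ?ltW // -/k invfM mulrCA mulrA.
Qed.

Lemma refl_poly_cat (L M : seq C) : refl_poly (L ++ M) = refl_poly L * refl_poly M.
Proof. exact: big_cat. Qed.

Lemma disc_fracX (p : {poly C}) (L : seq C) m z :
  disc_frac (p ^+ m) (flatten (nseq m L)) z = disc_frac p L z ^+ m.
Proof.
rewrite /disc_frac horner_exp expr_div_n; congr (_ / _).
elim: m => [|m IH] /=; first by rewrite /refl_poly big_nil hornerC.
by rewrite refl_poly_cat hornerM IH exprS.
Qed.

Lemma poisson_sumX (L : seq C) m z :
  poisson_sum (flatten (nseq m L)) z = m%:R * poisson_sum L z.
Proof.
elim: m => [|m IH]; first by rewrite /= /poisson_sum big_nil mul0r.
by rewrite /= /poisson_sum big_cat /= -!/(poisson_sum _ _) IH mulrS mulrDl mul1r.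
Qed.

Lemma disc_frac_exp_bound (p : {poly C}) (L : seq C) m z :
  in_disc L -> (size p <= (size L).+1)%N ->
  cmod z = 1 ->
  cmod (disc_frac p L z) ^+ (2 * m) <= (1 + m%:R * poisson_sum L z) *
    circle_avg (fun w => cmod (disc_frac p L w) ^+ (2 * m)).
Proof.
move=> L1 sp z1.
have L1' : in_disc (flatten (nseq m L)).
  by elim: m => //= m IH; rewrite /in_disc all_cat; apply/andP.
have sp' : (size (p ^+ m) <= (size (flatten (nseq m L))).+1)%N.
  apply: leq_trans (size_poly_exp_leq _ _) _.
  rewrite ltnS size_flatten /shape map_nseq sumn_nseq.
  by rewrite leq_mul2r -subn1 leq_subLR add1n sp orbT.
have E w : cmod (disc_frac (p ^+ m) (flatten (nseq m L)) w) ^+ 2 =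
    cmod (disc_frac p L w) ^+ (2 * m).
  by rewrite disc_fracX cmodX -exprM mulnC.
have := disc_frac_bound L1' sp' z1; rewrite E poisson_sumX.
by under eq_fun do rewrite E.
Qed.

End PoleList.

(** * Poles and values of R_1 in terms of those of R *)

Section JoukowskiComposite.
Variable K : realType.
Local Notation C := K[i].
Local Notation Re := (@complex.Re K).
Variable f : {fraction {poly C}}.
Hypothesis hf : forall x : K, segI x -> ~~ is_pole f (Some x%:C).
Implicit Types (z : C) (x : K).

Let g := rcomp f (joukowski C).
Let n := rdegree f.

Lemma two_neq0C : (2 : C) != 0.
Proof. by rewrite pnatr_eq0. Qed.

Lemma size_rnum_rdegree : (size (rnum f) <= n.+1)%N.
Proof.
rewrite /n rdegreeE size_pole_seq; apply: leq_trans (leqSpred _) _.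
by rewrite ltnS leq_maxr.
Qed.

Lemma size_rden_rdegree : (size (rden f) <= n.+1)%N.
Proof.
rewrite /n rdegreeE size_pole_seq; apply: leq_trans (leqSpred _) _.
by rewrite ltnS leq_maxl.
Qed.

Lemma joukowski_circle z : cmod z = 1 -> 2^-1 * (z + z^-1) = (Re z)%:C.
Proof.
move=> z1; rewrite -(unit_circle_conj z1) addcJ_Re rmorphM rmorph_nat.
by rewrite mulKf ?two_neq0C.
Qed.

Lemma segI_Re z : cmod z = 1 -> segI (Re z).
Proof.
by move=> z1; rewrite /segI /= in_itv /= -ler_norml -z1 ler_Re_cmod.
Qed.

Lemma rden_segI x : segI x -> (rden f).[x%:C] != 0.
Proof. by move=> /hf; rewrite is_pole_root. Qed.

Lemma joukowski_num_rden_neq0 : joukowski_num n (rden f) != 0.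
Proof.
have J1 : 2^-1 * (1 + 1^-1) = (1 : K)%:C :> C.
  by rewrite invr1 rmorph1; field.
(* The point 1 is fixed by the Joukowski map and belongs to I, where R has no pole. *)
have : (joukowski_num n (rden f)).[1] != 0.
  rewrite (horner_joukowski_num two_neq0C size_rden_rdegree) ?oner_neq0 //.
  rewrite J1 mulf_neq0 ?expf_neq0 ?mulr1 ?two_neq0C // rden_segI //.
  by rewrite /segI /= in_itv /=; lra.
by apply: contraNneq => ->; rewrite horner0.
Qed.

Lemma rcomp_cross :
  rnum g * joukowski_num n (rden f) = joukowski_num n (rnum f) * rden g.
Proof.
exact (rcomp_joukowskiE two_neq0C size_rnum_rdegree size_rden_rdegree
  joukowski_num_rden_neq0).
Qed.

(** The point 0 is exceptional because the Joukowski map sends it to infinity. Elsewhere [rnum g]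
    does not vanish at a root of [rden g], so the other factor in [rcomp_cross] must. *)
Lemma root_rden_rcomp z : root (rden g) z ->
  z = 0 \/ root (rden f) (2^-1 * (z + z^-1)).
Proof.
move=> rz; have [->|z0] := eqVneq z 0; [by left | right].
have /(congr1 (fun p : {poly C} => p.[z])) := rcomp_cross.
rewrite !hornerM (eqP rz) mulr0 (horner_joukowski_num two_neq0C size_rden_rdegree z0).
have Pz : (rnum g).[z] != 0.
  by apply: coprimep_root rz; rewrite coprimep_sym coprimep_rnum_rden.
move=> /eqP; rewrite !mulf_eq0 (negbTE Pz) expf_eq0 mulf_eq0 (negbTE two_neq0C) (negbTE z0).
by rewrite andbF orbF.
Qed.

Lemma rden_rcomp_circle z : cmod z = 1 -> ~~ root (rden g) z.
Proof.
move=> z1; apply/negP => /root_rden_rcomp[z0|].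
  by move: z1; rewrite z0 cmod0 => /esym/eqP; rewrite oner_eq0.
by rewrite joukowski_circle // rootE (negbTE (rden_segI (segI_Re z1))).
Qed.

Lemma reval_rcomp_circle z : cmod z = 1 -> reval g z = reval f (Re z)%:C.
Proof.
move=> z1; have z0 : z != 0 by rewrite -cmod_gt0 z1.
have /(congr1 (fun p : {poly C} => p.[z])) := rcomp_cross.
rewrite !hornerM (horner_joukowski_num two_neq0C size_rden_rdegree z0).
rewrite (horner_joukowski_num two_neq0C size_rnum_rdegree z0) joukowski_circle //.
have w0 : (2 * z) ^+ n != 0 by rewrite expf_neq0 // mulf_neq0 // two_neq0C.
have Q0 := rden_rcomp_circle z1; rewrite rootE in Q0.
have B0 := rden_segI (segI_Re z1).
rewrite mulrA [RHS]mulrAC => /(mulIf w0) e.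
by apply/eqP; rewrite /reval eqr_div // e.
Qed.

(** By coprimality, [rcomp_cross] shows that [rden g] and [rnum g] divide the cleared denominator
    and numerator, each of degree at most 2n. A zero numerator is treated apart, as divisibility
    then bounds nothing. *)
Lemma size_disc_poles : (size (disc_poles g) <= 2 * n)%N.
Proof.
rewrite size_map size_pole_seq geq_max -!subn1 !leq_subLR !add1n; apply/andP; split.
  apply: leq_trans _ (size_joukowski_num two_neq0C size_rden_rdegree).
  apply: dvdp_leq joukowski_num_rden_neq0 _.
  have cop : coprimep (rden g) (rnum g) by rewrite coprimep_sym coprimep_rnum_rden.
  by rewrite -(Gauss_dvdpr _ cop) rcomp_cross dvdp_mull.
have [e|A0] := eqVneq (joukowski_num n (rnum f)) 0.
  have := rcomp_cross; rewrite e mul0r => /eqP.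
  rewrite mulf_eq0 (negbTE joukowski_num_rden_neq0) orbF => /eqP ->.
  by rewrite size_poly0.
apply: leq_trans _ (size_joukowski_num two_neq0C size_rnum_rdegree).
apply: dvdp_leq A0 _.
by rewrite -(Gauss_dvdpl _ (coprimep_rnum_rden g)) -rcomp_cross dvdp_mulr.
Qed.

Lemma cR_multE z : cmod z < 1 -> cR_mult f z = count_mem z (disc_poles g).
Proof.
move=> z1; rewrite /cR_mult -/g !pole_multE /disc_poles count_into_disc //.
exact/all_pole_seq_circle/rden_rcomp_circle.
Qed.

Lemma in_disc_rcomp : in_disc (disc_poles g).
Proof. exact/in_disc_poles/rden_rcomp_circle. Qed.

(** The reflected poles listed with repetition are the points of [cR_poles f] with multiplicities
    [cR_mult f], so [mu0] is the kernel term of the reproducing bound. *)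
Lemma mu0E z : mu0 f z = poisson_sum (disc_poles g) z.
Proof.
rewrite /mu0 /poisson_sum -[RHS](@big_fsbig_count _ _ _ (cR_poles f)); last first.
  move=> a aL; have a1 := allP in_disc_rcomp _ aL.
  by split=> //; rewrite cR_multE // -has_count has_pred1.
by apply: eq_fsbigr => a; rewrite inE => -[a1 _]; rewrite cR_multE // -mulrA mulr_natl.
Qed.

Lemma mu0_ge0 z : 0 <= mu0 f z.
Proof. by rewrite mu0E poisson_sum_ge0 // in_disc_rcomp. Qed.

(** Since |z - b| >= 1 - |b| on the circle, each summand is at most (1 - |b|^2) / (1 - |b|)^2 = (1 +
    |b|) / (1 - |b|). *)
Lemma poisson_sum_le (L : seq C) (c : K) z : cmod z = 1 -> in_disc L ->
  (forall b, b \in L -> (1 + cmod b) / (1 - cmod b) <= c) ->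
  poisson_sum L z <= (size L)%:R * c.
Proof.
move=> z1 L1 Lc; have -> : (size L)%:R * c = \sum_(b <- L) c.
  by rewrite big_const_seq iter_addr_0 count_predT mulr_natl.
rewrite /poisson_sum.
rewrite big_seq [leRHS]big_seq; apply: ler_sum => b bL.
have b1 : cmod b < 1 := allP L1 _ bL; have b0 := cmod_ge0 b.
apply: le_trans (Lc b bL).
have h := cmodBB z b; rewrite z1 in h.
have h1 : 0 < 1 - cmod b by rewrite subr_gt0.
have h2 : 0 < cmod (z - b) by exact: lt_le_trans h.
rewrite ler_pdivrMr ?exprn_gt0 // mulrAC ler_pdivlMr //.
rewrite (_ : (1 - cmod b ^+ 2) * (1 - cmod b) =
  (1 + cmod b) * (1 - cmod b) ^+ 2); last by ring.
by rewrite ler_wpM2l ?addr_ge0 // ler_sqr // nnegrE; exact: ltW.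
Qed.

Lemma mu0_le_sup z : cmod z = 1 -> mu0 f z <= mu0_sup f.
Proof.
move=> z1; rewrite -[leLHS](ger0_norm (mu0_ge0 z)); apply: sup_upper_bound.
  split; first by exists `|mu0 f 1|; exists 1 => //; exact: cmod1.
  (* A crude bound: the sum over all poles dominates each single quotient. Any upper bound will do,
     its existence being what makes [sup] a true supremum. *)
  exists ((size (disc_poles g))%:R *
    \sum_(b <- disc_poles g) (1 + cmod b) / (1 - cmod b)).
  move=> _ [w w1 <-]; rewrite ger0_norm ?mu0_ge0 // mu0E.
  apply: poisson_sum_le => // [|b bL]; first exact: in_disc_rcomp.
  rewrite (big_rem b) //= lerDl big_seq sumr_ge0 // => a /mem_rem aL.
  have a1 : cmod a < 1 := allP in_disc_rcomp _ aL.
  by apply: divr_ge0; [rewrite addr_ge0 ?cmod_ge0 | rewrite subr_ge0 ltW].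
by exists z.
Qed.

End JoukowskiComposite.

(** * From the pointwise bound to the norm inequalities *)

Section WeightedNorms.
Variable K : realType.
Local Notation mu := (@lebesgue_measure K).
Variable h : K -> K.
Hypothesis ch : {within (@segI K), continuous h}.
Hypothesis h0 : forall x, 0 <= h x.

Definition omega_integral (r : K) : \bar K :=
  (\int[mu]_(x in (@segI K)) (h x `^ r * omega x)%:E)%E.

Lemma measurable_powR_omega (r : K) :
  measurable_fun (@segI K) (fun x => (h x `^ r * omega x)%:E).
Proof.
apply: measurable_mul_omega.
apply: (@measurableT_comp _ _ _ _ _ _ (fun y : K => y `^ r)).
  exact: measurable_powR.
exact: measurable_segI_continuous.
Qed.

Lemma omega_integral_ge0 (r : K) : (0 <= omega_integral r)%E.
Proof.
by apply: integral_ge0 => x _; rewrite lee_fin mulr_ge0 ?powR_ge0 ?omega_ge0.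
Qed.

Lemma omega_integral_le (M p r : K) : 0 < p -> p <= r ->
  (forall x, segI x -> h x <= M) ->
  (omega_integral r <= (M `^ (r - p))%:E * omega_integral p)%E.
Proof.
move=> p0 pr hM; rewrite /omega_integral -ge0_integralZl //; first last.
- by rewrite lee_fin powR_ge0.
- by move=> x _; rewrite lee_fin mulr_ge0 ?powR_ge0 ?omega_ge0.
- exact: measurable_powR_omega.
- exact: measurable_itv.
apply: ge0_le_integral.
- exact: measurable_itv.
- by move=> x _; rewrite lee_fin mulr_ge0 ?powR_ge0 ?omega_ge0.
- exact: measurable_powR_omega.
- by apply: measurable_funeM; exact: measurable_powR_omega.
move=> x xI; rewrite -EFinM lee_fin mulrA ler_wpM2r ?omega_ge0 //.
have [->|hx0] := eqVneq (h x) 0.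
  by rewrite powR0 ?mulr_ge0 ?powR_ge0 // gt_eqF // (lt_le_trans p0).
have -> : h x `^ r = h x `^ (r - p) * h x `^ p.
  by rewrite -powRD ?subrK // hx0 implybT.
rewrite ler_wpM2r ?powR_ge0 // ge0_ler_powR ?subr_ge0 ?nnegrE ?hM //.
exact: le_trans (hM _ xI).
Qed.

Lemma exists_max_segI : exists2 M : K, 0 <= M &
  (forall x, segI x -> h x <= M) /\ exists2 x, segI x & h x = M.
Proof.
have [|c cI cM] := @EVT_max K h (-1) 1 _ ch; first by lra.
by exists (h c) => //; split=> [x xI|]; [exact: cM | exists c].
Qed.

(** Descent from the even exponent to p: h^(2m) <= M^(2m-p) h^p under the integral, after which
    M^(2m-p) is cancelled. This needs M nonzero and a finite integral; the two remaining cases are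
    immediate. *)
Lemma max_powR_le (L M p : K) (m : nat) : 0 < p -> p <= (2 * m)%:R -> 0 < L ->
  0 <= M -> (forall x, segI x -> h x <= M) ->
  ((M ^+ (2 * m))%:E <= L%:E * omega_integral (2 * m)%:R)%E ->
  ((M `^ p)%:E <= L%:E * omega_integral p)%E.
Proof.
move=> p0 pm L0 M0 hM hmax.
have [->|Mn0] := eqVneq M 0.
  by rewrite powR0 ?gt_eqF // mule_ge0 ?omega_integral_ge0 // lee_fin ltW.
have Mp : 0 < M by rewrite lt_neqAle eq_sym Mn0.
have := le_trans hmax (lee_wpmul2l _ (omega_integral_le p0 pm hM)).
rewrite lee_fin ltW // => /(_ isT).
have := omega_integral_ge0 p; case: (omega_integral p) => [v| |] //; last first.
  by move=> _ _; rewrite gt0_muley ?lte_fin // leey.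
rewrite -!EFinM !lee_fin => v0.
have -> : M ^+ (2 * m) = M `^ ((2 * m)%:R - p) * M `^ p.
  by rewrite -powRD ?subrK ?powR_mulrn // Mn0 implybT.
rewrite mulrCA ler_pM2l // powR_gt0 //.
Qed.

Lemma wnorm_oo_le (L M p : K) : 0 < p -> 0 < L -> 0 <= M ->
  ((M `^ p)%:E <= L%:E * omega_integral p)%E ->
  (M%:E <= (L `^ p^-1)%:E * poweR (omega_integral p) p^-1)%E.
Proof.
move=> p0 L0 M0; have := omega_integral_ge0 p.
case: (omega_integral p) => [v| |] //; last first.
  move=> *; rewrite (@poweRyr K p^-1) ?gt_eqF ?invr_gt0 //.
  by rewrite gt0_muley ?leey // lte_fin powR_gt0.
rewrite poweR_EFin -!EFinM !lee_fin => v0 e.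
rewrite -powRM ?(ltW L0) // -(powRr1 M0) -(mulfV (lt0r_neq0 p0)) powRrM.
by rewrite ge0_ler_powR ?invr_ge0 ?(ltW p0) // nnegrE ?powR_ge0 // mulr_ge0 // ltW.
Qed.

(** Write v for the p-integral. From h^r <= M^(r-p) h^p and M <= (L v)^(1/p), the r-norm is at most
    (L v)^((r-p)/(pr)) v^(1/r). As (r - p)/(pr) = 1/p - 1/r, the powers of v combine to v^(1/p). *)
Lemma wnorm_fin_le (L M p r : K) : 0 < p -> p < r -> 0 < L -> 0 <= M ->
  (forall x, segI x -> h x <= M) ->
  ((M `^ p)%:E <= L%:E * omega_integral p)%E ->
  (poweR (omega_integral r) r^-1 <=
   (L `^ (p^-1 - r^-1))%:E * poweR (omega_integral p) p^-1)%E.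
Proof.
move=> p0 pr L0 M0 hM; have r0 : 0 < r by exact: lt_trans pr.
have := omega_integral_le p0 (ltW pr) hM.
have := omega_integral_ge0 r; have := omega_integral_ge0 p.
case: (omega_integral p) => [v| |] //; last first.
  move=> *; rewrite (@poweRyr K p^-1) ?gt_eqF ?invr_gt0 //.
  by rewrite gt0_muley ?leey // lte_fin powR_gt0.
case: (omega_integral r) => [w| |] //.
rewrite !poweR_EFin -!EFinM !lee_fin => v0 w0 wv e.
have rp : 0 < r - p by rewrite subr_gt0.
apply: le_trans (_ : (M `^ (r - p) * v) `^ r^-1 <= _).
  by rewrite ge0_ler_powR ?invr_ge0 ?(ltW r0) // nnegrE mulr_ge0 // powR_ge0.
have [vz|vn0] := eqVneq v 0.
  by rewrite vz mulr0 (@powR0 K r^-1) ?gt_eqF ?invr_gt0 ?mulr_ge0 ?powR_ge0.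
have s0 : 0 <= p^-1 - r^-1 by rewrite subr_ge0 lef_pV2 ?posrE // ltW.
have eM : M `^ (r - p) <= (L * v) `^ (r * (p^-1 - r^-1)).
  rewrite (_ : r - p = p * (r * (p^-1 - r^-1))); last by field; rewrite !gt_eqF.
  by rewrite powRrM ge0_ler_powR ?mulr_ge0 ?(ltW r0) // nnegrE ?powR_ge0 // mulr_ge0 // ltW.
apply: le_trans (_ : ((L * v) `^ (r * (p^-1 - r^-1)) * v) `^ r^-1 <= _).
  rewrite ge0_ler_powR ?invr_ge0 ?(ltW r0) ?nnegrE ?mulr_ge0 ?powR_ge0 //.
  by rewrite ler_wpM2r.
rewrite powRM ?powR_ge0 // -powRrM mulrAC mulfV ?gt_eqF // mul1r.
rewrite powRM ?(ltW L0) // -mulrA -powRD ?subrK //.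
by rewrite vn0 implybT.
Qed.

End WeightedNorms.

(** * The pointwise bound on I and the passage between exponents for R *)

Section BernsteinNikolskii.
Variable K : realType.
Local Notation C := K[i].
Local Notation Re := (@complex.Re K).
Variable f : {fraction {poly C}}.
Hypothesis hf : forall x : K, segI x -> ~~ is_pole f (Some x%:C).

Let h (x : K) : K := cmod (reval f x%:C).

Lemma continuous_cmod_reval : {within (@segI K), continuous h}.
Proof.
apply: continuous_in_subspaceT => x; rewrite inE => xI.
have -> : h = (fun y => cmod (rnum f).[y%:C] * (cmod (rden f).[y%:C])^-1).
  by apply/funext => y; rewrite /h /reval cmodM cmodV.
apply: cvgM.
  exact: (continuous_cmod (continuousC_horner (rnum f) (@continuousC_real K))).
apply: cvgV; first by rewrite cmod_eq0 (rden_segI hf).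
exact: (continuous_cmod (continuousC_horner (rden f) (@continuousC_real K))).
Qed.

Lemma cmod_reval_exp_bound (m : nat) (z : C) : cmod z = 1 ->
  ((h (Re z) ^+ (2 * m))%:E <=
   ((m%:R * mu0 f z + 1) / pi)%:E * omega_integral h (2 * m)%:R)%E.
Proof.
move=> z1; set g := rcomp f (joukowski C).
have [p [sp pE]] := cmod_reval_circle (rden_rcomp_circle hf).
have hE w : cmod w = 1 -> cmod (disc_frac p (disc_poles g) w) = h (Re w).
  by move=> w1; rewrite /g -pE // reval_rcomp_circle.
have L1 := in_disc_rcomp hf.
have cint : continuous (fun t : K =>
    cmod (disc_frac p (disc_poles g) (cis t)) ^+ (2 * m)).
  move=> t; apply: (@continuous_comp _ _ _
    (fun s => cmod (disc_frac p (disc_poles g) (cis s))) (fun y : K => y ^+ (2 * m))).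
    exact: (circle_cont_cmod_disc_frac L1).
  exact: exprn_continuous.
have := disc_frac_exp_bound m L1 sp z1; rewrite -/g hE // -mu0E //.
(* The modulus depends only on Re z, so it is invariant under conjugation and the average becomes
   1/pi times an integral over [0, pi]. This is the origin of the factor 1/pi. *)
rewrite circle_avg_even; last first.
- by move=> w w1; rewrite !hE ?cmodJ //; case: (w).
- exact: cint.
set I := Rintegral _ _ _ => b1.
have c0 : 0 <= m%:R * mu0 f z + 1 by rewrite addr_ge0 // mulr_ge0 // mu0_ge0.
apply: le_trans (_ : (((m%:R * mu0 f z + 1) / pi) * I)%:E <= _)%E.
  by rewrite lee_fin -mulrA [_ + 1]addrC.
rewrite EFinM lee_wpmul2l ?lee_fin ?divr_ge0 ?pi_ge0 //.
rewrite fineK; last first.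
  by apply: integrable_fin_num => //; exact: (continuous_integrable_0pi cint).
have ch2 : {within (@segI K), continuous (fun x => h x ^+ (2 * m))}.
  move=> x; apply: (@continuous_comp (subspace _) _ _ h (fun y : K => y ^+ (2 * m))).
    exact: continuous_cmod_reval.
  exact: exprn_continuous.
have := integral_cos_le_omega ch2 (fun x _ => exprn_ge0 _ (cmod_ge0 _)).
rewrite /omega_integral.
congr (_ <= _)%E; apply: eq_integral => x _; last by rewrite powR_mulrn ?cmod_ge0.
by rewrite hE ?cmod_cis.
Qed.

Lemma segI_circle (x : K) : segI x -> exists2 z : C, cmod z = 1 & Re z = x.
Proof.
rewrite /segI /= in_itv /= => x1; exists (cis (acos x)); first exact: cmod_cis.
by rewrite /= acosK // in_itv.
Qed.

Lemma wnorm_exp_even (m : nat) : (0 < m)%N ->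
  (wnorm (2 * m)%:R%:E f ^+ (2 * m) = omega_integral h (2 * m)%:R)%E.
Proof.
move=> m0; have m2 : (2 * m)%:R != 0 :> K by rewrite pnatr_eq0 muln_eq0 /= -lt0n.
rewrite /wnorm -/(omega_integral h _).
have := omega_integral_ge0 h (2 * m)%:R; case: (omega_integral _ _) => [v| |] //.
  rewrite lee_fin poweR_EFin -EFin_expe => v0.
  by rewrite -powR_mulrn ?powR_ge0 // -powRrM mulVf // powRr1.
rewrite poweRyr ?invr_eq0 // => _; have : (0 < 2 * m)%N by rewrite muln_gt0.
case: (2 * m)%N => // k _; elim: k => // k IH.
by rewrite expeS IH mulyy.
Qed.

(** Common source of both norm inequalities, which differ only in the uniform majorant [L] of the
    pointwise constant. The pointwise bound is used at a circle point above a maximum of |R|. *)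
Lemma nikolskii_of_bound (L p : K) (q : \bar K) (m : nat) : 0 < L -> 0 < p ->
  (p%:E < q)%E -> p / 2 <= m%:R ->
  (forall z : C, cmod z = 1 -> (m%:R * mu0 f z + 1) / pi <= L) ->
  (wnorm q f <= (L `^ (p^-1 - inv_exponent q))%:E * wnorm p%:E f)%E.
Proof.
move=> L0 p0 pq pm hL.
have ch := continuous_cmod_reval.
have h0 x : 0 <= h x by exact: cmod_ge0.
have [M M0 [hM [x0 x0I x0M]]] := exists_max_segI ch h0.
have pm2 : p <= (2 * m)%:R by rewrite natrM; lra.
have bM : ((M `^ p)%:E <= L%:E * omega_integral h p)%E.
  apply: (max_powR_le ch h0 p0 pm2 L0 M0 hM).
  have [z z1 zx] := segI_circle x0I.
  rewrite -x0M -zx; apply: le_trans (cmod_reval_exp_bound m z1) _.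
  by rewrite lee_wpmul2r ?omega_integral_ge0 // lee_fin hL.
case: q pq => [r| |] //= pr.
- exact: (wnorm_fin_le ch h0 p0 pr L0 M0 hM bM).
- rewrite subr0; apply: le_trans (wnorm_oo_le p0 L0 M0 bM).
  by apply: ge_ereal_sup => _ [x xI <-]; rewrite lee_fin; exact: hM.
Qed.

End BernsteinNikolskii.

(** * Poles outside an ellipse *)

Section EllipseExterior.
Variable K : realType.
Local Notation C := K[i].
Local Notation Re := (@complex.Re K).
Local Notation Im := (@complex.Im K).
Variable delta : K.
Hypothesis delta1 : 1 < delta.

(** The quadratic form normalised by the semi-axes, so that the ellipse is its level 1. *)
Definition ellipse_form (w : K * K) : K :=
  (w.1 / (2^-1 * (delta + delta^-1))) ^+ 2 +
  (w.2 / (2^-1 * (delta - delta^-1))) ^+ 2.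

Let a := 2^-1 * (delta + delta^-1).
Let b := 2^-1 * (delta - delta^-1).

Let d0 : 0 < delta. Proof. exact: lt_trans delta1. Qed.
Let dV : 0 < delta^-1 < 1.
Proof. by rewrite invr_gt0 d0 invf_lt1. Qed.
Let a0 : 0 < a. Proof. by have := dV; have := delta1; rewrite /a; nra. Qed.
Let b0 : 0 < b. Proof. by have := dV; have := delta1; rewrite /b; nra. Qed.

Lemma ellipse_form_eq1 w : ellipse_form w = 1 -> ellipse delta w.
Proof.
move=> e; have [|t _] := @unit_circleP K ((w.1 / a) +i* (w.2 / b)).
  by apply/eqP; rewrite -(@eqrXn2 _ 2) ?cmod_ge0 // sqr_cmod expr1n; apply/eqP.
have an : a != 0 by rewrite gt_eqF.
have bn : b != 0 by rewrite gt_eqF.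
rewrite /cis => -[] [e1 e2]; [exists t | exists (- t)] => //;
  rewrite -/a -/b -e1 -e2 [a * _]mulrC [b * _]mulrC !divfK //; by case: (w).
Qed.

Lemma continuous_ellipse_form : continuous ellipse_form.
Proof.
move=> w; apply: cvgD; apply: cvgM; apply: cvgM;
  try exact: cvg_cst; try exact: cvg_fst; exact: cvg_snd.
Qed.

(* A connected set that avoids the ellipse cannot cross the level 1 of the form. *)
Lemma ellipse_component_bounded w : ellipse_form w <= 1 ->
  bounded_set (connected_component (~` ellipse delta) w).
Proof.
move=> w1; set A := connected_component _ _.
suff A1 v : A v -> ellipse_form v <= 1.
  exists (a + b); split; first exact: num_real.
  move=> x abx v /A1; rewrite /ellipse_form -/a -/b => v1.
  have sq1 (u c : K) : 0 < c -> (u / c) ^+ 2 <= 1 -> `|u| <= c.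
    move=> c0; rewrite -[leRHS](expr1n _ 2) -ler_sqrt ?expr1n // sqrtr_sqr sqrtr1.
    by rewrite normrM normfV (gtr0_norm c0) ler_pdivrMr // mul1r.
  have h1 : `|v.1| <= a by apply: sq1 => //; apply: le_trans v1; rewrite lerDl sqr_ge0.
  have h2 : `|v.2| <= b by apply: sq1 => //; apply: le_trans v1; rewrite lerDr sqr_ge0.
  rewrite /= prod_normE ge_max; apply/andP; split.
    by apply: le_trans h1 _; apply: ltW; apply: le_lt_trans abx; rewrite lerDl ltW.
  by apply: le_trans h2 _; apply: ltW; apply: le_lt_trans abx; rewrite lerDr ltW.
move=> Av; rewrite leNgt; apply/negP => v1.
have Ae u : A u -> ellipse_form u != 1.
  move=> /connected_component_sub Au; apply/eqP => /ellipse_form_eq1; exact: Au.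
(* If w lay on the ellipse, its component would be empty by convention, which [Av] excludes. *)
have Aw : A w.
  apply: contrapT => Aw; move: Av; rewrite /A connected_component_out // => nw.
  by apply: Aw; exact: connected_component_refl.
have cA : connected (ellipse_form @` A).
  apply: connected_continuous_connected; first exact: component_connected.
  exact/continuous_subspaceT/continuous_ellipse_form.
have /connected_intervalP iA := cA.
have [u Au u1] : (ellipse_form @` A) 1.
  by apply: (iA (ellipse_form w) (ellipse_form v)); [exists w|exists v|rewrite w1 ltW].
by have := Ae u Au; rewrite u1 eqxx.
Qed.

(** The circle of radius r is mapped onto the confocal ellipse with semi-axes (r + 1/r)/2 and |r -
    1/r|/2 (a segment if r = 1). For r between 1/delta and delta neither exceeds the corresponding
    semi-axis of the given ellipse. *)
Lemma ellipse_form_joukowski (z : C) : z != 0 -> delta^-1 <= cmod z <= delta ->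
  ellipse_form (Re (2^-1 * (z + z^-1)), Im (2^-1 * (z + z^-1))) <= 1.
Proof.
move=> z0 /andP[zd1 zd2]; set r := cmod z in zd1 zd2.
have r0 : 0 < r by rewrite cmod_gt0.
have half : 2^-1 = (2^-1 : K)%:C :> C by rewrite fmorphV rmorph_nat.
rewrite /ellipse_form -/a -/b half /= !ReM !ImM ReD ImD ReV ImV /= !mul0r subr0 addr0.
rewrite -sqr_cmod -/r.
have s1 : (Re z / r) ^+ 2 + (Im z / r) ^+ 2 = 1.
  by rewrite !expr_div_n -mulrDl -sqr_cmod -/r mulfV // expf_neq0 // gt_eqF.
have -> : 2^-1 * (Re z + Re z / r ^+ 2) / a =
    (Re z / r) * ((r + r^-1) / (delta + delta^-1)).
  have := lt0r_neq0 a0; rewrite /a mulf_eq0 negb_or => /andP[_].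
  by move: (delta + delta^-1) => c c0; field; rewrite c0 gt_eqF.
have -> : 2^-1 * (Im z + - Im z / r ^+ 2) / b =
    (Im z / r) * ((r - r^-1) / (delta - delta^-1)).
  have := lt0r_neq0 b0; rewrite /b mulf_eq0 negb_or => /andP[_].
  by move: (delta - delta^-1) => c c0; field; rewrite c0 gt_eqF.
have p1 : 0 < delta + delta^-1 by have := a0; rewrite /a; lra.
have p2 : 0 < delta - delta^-1 by have := b0; rewrite /b; lra.
have rV : r * r^-1 = 1 by rewrite mulfV // gt_eqF.
have dVV : delta * delta^-1 = 1 by rewrite mulfV // gt_eqF.
have rV0 : 0 < r^-1 by rewrite invr_gt0.
have dV0 : 0 < delta^-1 by rewrite invr_gt0.
have rd1 : delta^-1 <= r^-1 by rewrite lef_pV2.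
have rd2 : r^-1 <= delta by rewrite invf_ple.
have q1 : ((r + r^-1) / (delta + delta^-1)) ^+ 2 <= 1.
  rewrite expr_div_n ler_pdivrMr ?exprn_gt0 // mul1r ler_sqr ?nnegrE; first last.
  - exact: ltW p1.
  - by rewrite addr_ge0 ?(ltW r0) ?(ltW rV0).
  rewrite -subr_ge0.
  have -> : delta + delta^-1 - (r + r^-1) = (delta - r) * (delta - r^-1) * delta^-1.
    by field; rewrite !gt_eqF.
  by rewrite !mulr_ge0 ?subr_ge0 // ltW.
have q2 : ((r - r^-1) / (delta - delta^-1)) ^+ 2 <= 1.
  rewrite expr_div_n ler_pdivrMr ?exprn_gt0 // mul1r -[leLHS]real_normK ?num_real //.
  rewrite ler_sqr ?nnegrE ?(ltW p2) // ler_norml; apply/andP; split; lra.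
rewrite -s1; apply: lerD.
  by rewrite exprMn ler_piMr ?sqr_ge0.
by rewrite exprMn ler_piMr ?sqr_ge0.
Qed.

Lemma ellipse_ext_joukowski (z : C) : z != 0 ->
  ellipse_ext delta (Some (2^-1 * (z + z^-1))) -> cmod z < delta^-1 \/ delta < cmod z.
Proof.
move=> z0 /= ext; have [|zd1] := ltP (cmod z) delta^-1; first by left.
have [|zd2] := ltP delta (cmod z); first by right.
case: ext; apply: ellipse_component_bounded; apply: ellipse_form_joukowski => //.
by rewrite zd1.
Qed.

(** A pole of R_1 is 0 or infinity, both moved to 0, or it lies over a pole of R and so outside the
    annulus 1/delta <= |w| <= delta. Reflection exchanges the two sides of that annulus. *)
Lemma cmod_disc_pole_le (f : {fraction {poly C}}) (c : C) :
  (forall x : K, segI x -> ~~ is_pole f (Some x%:C)) ->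
  (forall o : option C, is_pole f o -> ellipse_ext delta o) ->
  c \in disc_poles (rcomp f (joukowski C)) -> cmod c <= delta^-1.
Proof.
move=> hf ext /mapP[y]; have /andP[dV0 dV1] := dV.
have c0 : cmod (0 : C) <= delta^-1 by rewrite cmod0 ltW.
rewrite mem_cat => /orP[/mapP[w]|/nseqP[-> _] -> //].
rewrite mem_den_roots => /(root_rden_rcomp hf) rw -> ->.
have [->|w0] := eqVneq w 0; first by rewrite /into_disc cmod0 ltr01.
case: rw => [/eqP|]; first by rewrite (negbTE w0).
rewrite -is_pole_root => /ext /(ellipse_ext_joukowski w0) wd.
rewrite /into_disc; case: ltP => w1.
  by case: wd => [/ltW //|]; rewrite ltNge (ltW (lt_trans w1 delta1)).
case: wd => [wd|/ltW wd]; first by move: wd; rewrite ltNge (le_trans (ltW dV1) w1).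
by rewrite cmodV cmodJ lef_pV2 // posrE cmod_gt0.
Qed.

Lemma mu0_ellipse_le (f : {fraction {poly C}}) (z : C) :
  (forall x : K, segI x -> ~~ is_pole f (Some x%:C)) ->
  (forall o : option C, is_pole f o -> ellipse_ext delta o) -> cmod z = 1 ->
  mu0 f z <= 2 * (rdegree f)%:R * ((delta + 1) / (delta - 1)).
Proof.
move=> hf ext z1; rewrite mu0E //.
have dm : 0 < delta - 1 by rewrite subr_gt0.
apply: le_trans (poisson_sum_le (c := (delta + 1) / (delta - 1)) z1 _ _) _.
- exact: in_disc_rcomp.
- move=> c cL; have c1 : cmod c < 1 := allP (in_disc_rcomp hf) _ cL.
  have := cmod_disc_pole_le hf ext cL.
  (* The function (1 + t)/(1 - t) is increasing on [0, 1[ and equals (delta + 1)/(delta - 1) at t =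
     1/delta. *)
  rewrite -[leRHS]div1r ler_pdivlMr // => cd.
  rewrite ler_pdivrMr ?subr_gt0 // mulrAC ler_pdivlMr //; nra.
rewrite -natrM ler_wpM2r ?ler_nat ?size_disc_poles // divr_ge0 ?(ltW dm) //.
by rewrite addr_ge0 // ltW.
Qed.

End EllipseExterior.

Theorem theorem6p1 (K : realType) (f : {fraction {poly K[i]}}) (n : nat)
  (hn : rdegree f = n)
  (hf : forall x : K, segI x -> ~~ is_pole f (Some x%:C)) :
  [/\ (forall (m : nat) (zeta : K[i]), (0 < m)%N -> unit_circle zeta ->
        ((cmod (reval f (2^-1 * (zeta + zeta^-1))) ^+ (2 * m)
          / (m%:R * mu0 f zeta + 1))%:E
         <= (pi^-1)%:E * wnorm (2 * m)%:R%:E f ^+ (2 * m))%E),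
      (forall (p : K) (q : \bar K) (mp : nat), 0 < p -> (p%:E < q)%E ->
        p / 2 <= mp%:R < 1 + p / 2 ->
        (wnorm q f
         <= (((mp%:R * mu0_sup f + 1) / pi) `^ (p^-1 - inv_exponent q))%:E
            * wnorm p%:E f)%E)
    & (forall delta : K, 1 < delta ->
        (forall a : option K[i], is_pole f a -> ellipse_ext delta a) ->
        forall (p : K) (q : \bar K) (mp : nat), 0 < p -> (p%:E < q)%E ->
        p / 2 <= mp%:R < 1 + p / 2 ->
        (wnorm q f
         <= ((pi^-1) `^ (p^-1 - inv_exponent q)
             * (2 * mp%:R * n%:R * ((delta + 1) / (delta - 1)) + 1)
               `^ (p^-1 - inv_exponent q))%:E
            * wnorm p%:E f)%E)].
Proof.
have pi0 := pi_gt0 K; split.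
- move=> m z m0 z1; rewrite (wnorm_exp_even f m0) joukowski_circle //.
  have c0 : 0 < m%:R * mu0 f z + 1 by rewrite ltr_pwDr // mulr_ge0 // mu0_ge0.
  have := cmod_reval_exp_bound hf m z1; rewrite EFinM -muleA => b1.
  rewrite mulrC EFinM; apply: le_trans (lee_wpmul2l _ b1) _.
    by rewrite lee_fin invr_ge0 ltW.
  by rewrite muleA -EFinM mulVf ?gt_eqF // mul1e.
- move=> p q m p0 pq /andP[pm _]; apply: (@nikolskii_of_bound _ _ hf _ _ _ m) => //.
    rewrite divr_gt0 // ltr_pwDr // mulr_ge0 //.
    exact: le_trans (mu0_ge0 hf 1) (mu0_le_sup hf (cmod1 _)).
  by move=> z z1; rewrite ler_pM2r ?invr_gt0 // lerD2r ler_wpM2l // mu0_le_sup.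
- move=> d d1 ext p q m p0 pq /andP[pm _].
  have B0 : 0 <= 2 * m%:R * n%:R * ((d + 1) / (d - 1)).
    by rewrite !mulr_ge0 // ?invr_ge0 ?subr_ge0 ?addr_ge0 ?(ltW d1) //;
      exact: le_trans (ltW d1).
  (* The two powers have the same exponent; merged, they give the single constant L for which the
     general inequality is stated. *)
  rewrite -powRM ?invr_ge0 ?(ltW pi0) ?addr_ge0 //.
  apply: (@nikolskii_of_bound _ _ hf _ _ _ m) => //.
    by rewrite mulr_gt0 ?invr_gt0 // ltr_pwDr.
  move=> z z1; rewrite mulrC ler_pM2l ?invr_gt0 // lerD2r.
  have := ler_wpM2l (ler0n K m) (mu0_ellipse_le d1 hf ext z1); rewrite hn.
  by rewrite !mulrA [m%:R * 2]mulrC.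
Qed.
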